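(* For any infinite dimensional Banach space $X$, the operator space $\max(X)$ is not exact.
   Context: An operator space is a closed subspace of $B(H)$ for some Hilbert space $H$; $\|\cdot\|_{cb}$ is the completely bounded norm and $d_{cb}(E,F)=\inf\{\|u\|_{cb}\|u^{-1}\|_{cb}\}$ over all isomorphisms $u\colon E\to F$ ($=\infty$ if none). For a finite dimensional operator space $E$, $d_{SK}(E)=\inf\{d_{cb}(E,F): F\subset K(\ell_2)\}$, where $K(\ell_2)$ is the algebra of compact operators on $\ell_2$. For an infinite dimensional operator space $Y$, $d_{SK}(Y)=\sup d_{SK}(E)$ over all finite dimensional subspaces $E\subset Y$; $Y$ is exact if $d_{SK}(Y)<\infty$. For a Banach space $X$, $\max(X)$ denotes $X$ equipped with its maximal operator space structure, characterized by the isometric identity $cb(\max(X),F)=B(X,F)$ for every operator space $F$. *)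

(* Defs.v *)
From HB Require Import structures.
From mathcomp Require Import all_boot all_order all_algebra.
From mathcomp Require Import sesquilinear complex lra ring.
From mathcomp Require Import boolp classical_sets functions reals ereal.
From mathcomp Require Import topology normedtype sequences.

Set Implicit Arguments.
Unset Strict Implicit.
Unset Printing Implicit Defensive.

Import Order.TTheory GRing.Theory Num.Theory.
Import numFieldNormedType.Exports.

Local Open Scope classical_set_scope.
Local Open Scope ring_scope.

(* In a normed space over R[i] the norm `|x| is an element of R[i]; [rnorm x] is
   the same norm as a real number. *)
Definition rnorm (R : realType) (V : normedZmodType R[i]) (x : V) : R :=
  complex.Re `|x|.

Section rnorm.
Variable R : realType.
Local Notation C := R[i].

Lemma rnormE (V : normedZmodType C) (x : V) : `|x| = (rnorm x)%:C%C.
Proof. by rewrite /rnorm RRe_real// normr_real. Qed.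

Lemma rnorm_ge0 (V : normedZmodType C) (x : V) : 0 <= rnorm x.
Proof. by rewrite -ler0c -rnormE. Qed.

Lemma ler_rnormD (V : normedZmodType C) (x y : V) :
  rnorm (x + y) <= rnorm x + rnorm y.
Proof. by rewrite -lecR rmorphD/= -!rnormE ler_normD. Qed.

Lemma rnormM (a b : C) : rnorm (a * b) = rnorm a * rnorm b.
Proof. by apply: complexI; rewrite rmorphM/= -!rnormE normrM. Qed.

Lemma rnorm_conj (a : C) : rnorm a^* = rnorm a.
Proof. by rewrite /rnorm norm_conjC. Qed.

Lemma cvg_real_complex {T : Type} {F : set_system T} {FF : Filter F}
  (f : T -> R) (l : R) :
  f @ F --> l -> (fun t => (f t)%:C%C : C^o) @ F --> (l%:C%C : C^o).
Proof.
move=> /cvgrPdist_lt fl; apply/cvgrPdist_lt => e e0.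
have ee : e = (complex.Re e)%:C%C by rewrite RRe_real// gtr0_real.
have e0' : 0 < complex.Re e by rewrite -ltcR -ee.
have := fl _ e0'; apply: filterS => t.
rewrite -rmorphB/= => h.
by rewrite normc_def /= expr0n addr0 sqrtr_sqr ee ltcR.
Qed.

Lemma cvg_complex {T : Type} {F : set_system T} {FF : Filter F}
  (f : T -> C) (a b : R) :
  complex.Re (f t) @[t --> F] --> a -> complex.Im (f t) @[t --> F] --> b ->
  (f : T -> C^o) @ F --> ((a +i* b)%C : C^o).
Proof.
move=> /cvg_real_complex fa /cvg_real_complex fb.
rewrite [X in _ --> X](complexE (a +i* b)%C)/=.
rewrite (_ : f = fun t => (complex.Re (f t))%:C%C + 'i%C * (complex.Im (f t))%:C%C); last first.
  by apply/funext => t; rewrite -complexE.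
apply: (@cvgD C C^o T F FF _ _ _ _ fa).
exact: (@cvgZl_tmp C C^o T F FF ('i%C : C) _ _ fb).
Qed.

Lemma ReB (x y : C) : complex.Re (x - y) = complex.Re x - complex.Re y.
Proof. by case: x y => [? ?] [? ?]. Qed.
Lemma ImB (x y : C) : complex.Im (x - y) = complex.Im x - complex.Im y.
Proof. by case: x y => [? ?] [? ?]. Qed.

Lemma ler_Re_rnorm (x : C) : `|complex.Re x| <= rnorm x.
Proof. by rewrite -lecR -rnormE normc_ge_Re. Qed.

Lemma ler_Im_rnorm (x : C) : `|complex.Im x| <= rnorm x.
Proof.
rewrite -lecR -rnormE.
have -> : complex.Im x = - complex.Re (x * 'i%C) by rewrite ReiNIm opprK.
rewrite normrN (le_trans (normc_ge_Re _))// normrM.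
by rewrite [X in _ * X]normc_def /= expr0n add0r expr1n sqrtr1 mulr1.
Qed.

Lemma complex_complete (F : set_system C^o) :
  ProperFilter F -> cauchy F -> cvg F.
Proof.
move=> PF /cauchyP cF.
have key (p : C^o -> R) : (forall x y, p (x - y) = p x - p y) ->
    (forall x, `|p x| <= rnorm x) -> cvg (p @ F).
  move=> pB pn; apply: cauchy_cvg; apply: cauchy_exP => e e0.
  have [|x Fx] := cF e%:C%C; first by rewrite ltcR.
  exists (p x); rewrite /=; apply: filterS Fx => y; rewrite /ball/= => xy.
  by rewrite -pB (le_lt_trans (pn _))// -ltcR -rnormE.
have /cvg_ex[/= a Fa] := key (@complex.Re R) ReB ler_Re_rnorm.
have /cvg_ex[/= b Fb] := key (@complex.Im R) ImB ler_Im_rnorm.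
apply/cvg_ex; exists (a +i* b)%C.
exact: (@cvg_complex _ F _ id).
Qed.

Lemma cvg_conjC {T : Type} {F : set_system T} {FF : Filter F}
  (f : T -> C^o) (l : C^o) : f @ F --> l -> (fun t => (f t)^* : C^o) @ F --> (l^* : C^o).
Proof.
move=> /cvgrPdist_lt fl; apply/cvgrPdist_lt => e /fl; apply: filterS => t.
by rewrite -rmorphB/= norm_conjC.
Qed.

Lemma normr_real_complex (r : R) : `|r%:C%C| = `|r|%:C%C :> C.
Proof. by rewrite normc_def /= expr0n addr0 sqrtr_sqr. Qed.

Lemma cvg_rnorm {T : Type} {F : set_system T} {FF : Filter F}
  (f : T -> C^o) (l : C^o) : f @ F --> l ->
  rnorm (f t : C) @[t --> F] --> rnorm (l : C).
Proof.
move=> /cvgrPdist_lt fl; apply/cvgrPdist_lt => e e0.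
have := fl e%:C%C; rewrite ltcR => /(_ e0); apply: filterS => t h.
rewrite -ltcR; apply: le_lt_trans h.
have := lerB_dist (l : C) (f t); have := lerB_dist (f t : C) l.
rewrite (distrC (f t)) -!normr_real_complex rmorphB/= -!rnormE => h1 h2.
by rewrite -rmorphB/= normr_real_complex [leRHS]rnormE lecR ler_norml lerNl opprB
  -!lecR !rmorphB/= -!rnormE h1 h2.
Qed.

End rnorm.

(* Hilbert spaces are complex; [ip] is a positive definite Hermitian form, linear
   in its first argument. *)
HB.mixin Record isHilbert (R : realType) H & CompleteNormedModule R[i] H := {
  ip : {dot H for Num.conj} ;
  sqr_norm_ip : forall x : H, `|x| ^+ 2 = ip x x }.

#[short(type="hilbertType")]
HB.structure Definition Hilbert (R : realType) :=
  {H of isHilbert R H & CompleteNormedModule R[i] H}.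

Section dot.
Variables (R : realType) (U : lmodType R[i]) (f : {dot U for Num.conj}).
Local Notation C := R[i].
Implicit Types u v : U.

Lemma dot_CauchySchwarz u v : `|f u v| ^+ 2 <= f u u * f v v.
Proof.
have [->|v0] := eqVneq v 0.
  by rewrite !linear0r normr0 expr0n/= mulr0.
have fv0 : 0 < f v v by rewrite dnorm_gt0.
pose a := f u v / f v v.
have := dnorm_ge0 f (u - a *: v).
rewrite dnormB dnormZ !(linearZr_LR f)/= /a.
have rv : (f v v)^* = f v v by rewrite conj_Creal// gtr0_real.
rewrite normrM normfV (gtr0_norm fv0) exprMn normCK.
rewrite !rmorphM/= !fmorphV/= rv conjCK.
set w := f u v; rewrite -/w in rv *; move: rv fv0.
set V := f v v; set W := f u u => rv V0.
rewrite rv (_ : _ - _ = W - (w * w^*) / V); last by field; rewrite gt_eqF.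
by rewrite subr_ge0 ler_pdivrMr.
Qed.

Definition dot_norm u : C := sqrtC (f u u).

Lemma dot_norm_ge0 u : 0 <= dot_norm u.
Proof. by rewrite sqrtC_ge0 dnorm_ge0. Qed.

Lemma ler_dot_normD u v : dot_norm (u + v) <= dot_norm u + dot_norm v.
Proof.
rewrite -(@ler_pXn2r _ 2)// ?nnegrE ?addr_ge0 ?dot_norm_ge0//.
rewrite sqrrD !sqrtCK addrAC dnormD lerD2l/=.
rewrite -mulr_natr -[_ + _](divfK (negbT (pnatr_eq0 C 2))) -ReE.
rewrite ler_pM2r ?ltr0n//; apply: (le_trans (leif_Re_Creal _)).
rewrite -(@ler_pXn2r _ 2)// ?nnegrE ?mulr_ge0 ?dot_norm_ge0//.
by rewrite exprMn !sqrtCK dot_CauchySchwarz.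
Qed.

Lemma dot_normZ (a : C) u : dot_norm (a *: u) = `|a| * dot_norm u.
Proof.
by rewrite /dot_norm dnormZ sqrtCM ?nnegrE ?exprn_ge0 ?dnorm_ge0// sqrCK.
Qed.

Lemma dot_norm0_eq0 u : dot_norm u = 0 -> u = 0.
Proof. by move=> /eqP; rewrite sqrt_dnorm_eq0 => /eqP. Qed.

End dot.

Section ell2.
Variable R : realType.
Local Notation C := R[i].

Definition sqsummable (x : nat -> C) : Prop :=
  cvgn (series (fun k => rnorm (x k) ^+ 2)).

Lemma nneg_series_cvgP (u : nat -> R) : (forall k, 0 <= u k) ->
  cvgn (series u) <-> exists M, forall n, series u n <= M.
Proof.
move=> u0; split=> [cu|[M uM]].
  exists (limn (series u)) => n; apply: nondecreasing_cvgn_le => //.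
  by apply/nondecreasing_seqP => m; rewrite seriesSr lerDl.
apply: nondecreasing_is_cvgn; last by exists M => _ [n _ <-].
by apply/nondecreasing_seqP => m; rewrite seriesSr lerDl.
Qed.

Lemma sqr_le_2sqrD (p q r : R) :
  0 <= r -> r <= p + q -> r ^+ 2 <= 2 * p ^+ 2 + 2 * q ^+ 2.
Proof.
move=> r0 rpq; have : r ^+ 2 <= (p + q) ^+ 2.
  by rewrite ler_sqr ?nnegrE// (le_trans r0).
have := sqr_ge0 (p - q); rewrite sqrrB sqrrD => ? ?; lra.
Qed.

Lemma mul_le_sqrD (p q : R) : p * q <= p ^+ 2 + q ^+ 2.
Proof.
have := sqr_ge0 (p - q); have := sqr_ge0 (p + q).
by rewrite sqrrB sqrrD => ? ?; lra.
Qed.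

Lemma sqsummableP x : sqsummable x <->
  exists M, forall n, series (fun k => rnorm (x k) ^+ 2) n <= M.
Proof. by apply: nneg_series_cvgP => k; rewrite sqr_ge0. Qed.

Lemma series_complex_cvg (z : nat -> C) (w : nat -> R) :
  (forall k, rnorm (z k) <= w k) -> cvgn (series w) ->
  cvgn (series z : nat -> C^o).
Proof.
move=> zw cw.
have key (p : C -> R) : p 0 = 0 -> {morph p : x y / x + y} ->
    (forall x, `|p x| <= rnorm x) -> cvgn (fun n => p (series z n)).
  move=> p0 pD pn.
  have -> : (fun n => p (series z n)) = series (p \o z).
    by apply/funext => n; rewrite /series/= (big_morph p pD p0).
  apply: normed_cvg; apply: (series_le_cvg _ _ _ cw) => n /=.
  - by [].
  - by rewrite (le_trans (rnorm_ge0 (z n))).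
  - exact: le_trans (pn _) (zw _).
have /cvg_ex[/= a Fa] := key (@complex.Re R) erefl
  (ltac:(by move=> [? ?] [? ?])) (@ler_Re_rnorm R).
have /cvg_ex[/= b Fb] := key (@complex.Im R) erefl
  (ltac:(by move=> [? ?] [? ?])) (@ler_Im_rnorm R).
by apply/cvg_ex; exists (a +i* b)%C; exact: cvg_complex.
Qed.

Definition sqsummable_pred : {pred (nat -> C)} := fun x => `[< sqsummable x >].

Lemma sqsummable_submod_closed : submod_closed sqsummable_pred.
Proof.
split=> [|a x y].
  apply/asboolP/sqsummableP; exists 0 => n.
  by rewrite /series/= big1// => k _; rewrite /rnorm normr0 expr0n.
move=> /asboolP/sqsummableP[M xM] /asboolP/sqsummableP[N yN].
apply/asboolP/sqsummableP; exists (2 * (rnorm a ^+ 2 * M) + 2 * N) => n.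
have a0 := sqr_ge0 (rnorm a).
have := yN n; have := ler_wpM2l a0 (xM n).
rewrite /series/= mulr_sumr => h1 h2.
have : \sum_(0 <= k < n) rnorm ((a *: x + y) k) ^+ 2 <=
    \sum_(0 <= k < n) (2 * (rnorm a ^+ 2 * rnorm (x k) ^+ 2) + 2 * rnorm (y k) ^+ 2).
  apply: ler_sum => k _.
  have := ler_rnormD (a * x k) (y k); rewrite rnormM.
  have := rnorm_ge0 (a * x k + y k); rewrite -exprMn.
  rewrite [(a *: x + y) k](_ : _ = a * x k + y k)//.
  exact: sqr_le_2sqrD.
move=> /le_trans; apply.
by rewrite big_split/= -!mulr_sumr mulr_sumr; apply: lerD; apply: ler_wpM2l.
Qed.
HB.instance Definition _ := GRing.isSubmodClosed.Build C _ sqsummable_pred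
  sqsummable_submod_closed.

Record ell2 := Ell2 { ell2_val :> nat -> C ; _ : ell2_val \in sqsummable_pred }.
HB.instance Definition _ := [isSub for ell2_val].
HB.instance Definition _ := [Choice of ell2 by <:].
HB.instance Definition _ := [SubChoice_isSubLmodule of ell2 by <:].

Lemma ell2P (x : ell2) : sqsummable x.
Proof. by case: x => x xP; exact/asboolP. Qed.

Definition ell2_ip (x y : ell2) : C^o :=
  limn (series (fun k => x k * (y k)^* : C^o)).

Lemma is_cvg_ell2_ip (x y : ell2) :
  cvgn (series (fun k => x k * (y k)^* : C^o)).
Proof.
apply: (@series_complex_cvg _ (fun k => rnorm (x k) ^+ 2 + rnorm (y k) ^+ 2)).
  move=> k; rewrite rnormM rnorm_conj.
  exact: mul_le_sqrD.
have := @is_cvg_seriesD R _ _ (@ell2P x) (@ell2P y).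
by congr (cvgn _); apply/funext.
Qed.

Lemma ell2_ip_linearl (y : ell2) : scalar (ell2_ip^~ y).
Proof.
move=> a u v; apply: (@cvg_lim C^o); first exact: (@norm_hausdorff C C^o).
have -> : series (fun k => (a *: u + v) k * (y k)^* : C^o) =
  (fun n => a *: (series (fun k => u k * (y k)^* : C^o) n) +
            series (fun k => v k * (y k)^* : C^o) n).
  apply/funext => n; rewrite /series/= scaler_sumr -big_split/=.
  by apply: eq_bigr => k _; rewrite mulrDl -scalerAl.
apply: (@cvgD C C^o); last exact: is_cvg_ell2_ip.
by apply: (@cvgZl_tmp C C^o); exact: is_cvg_ell2_ip.
Qed.

Lemma ell2_ip_herm (x y : ell2) : ell2_ip x y = (ell2_ip y x)^*.
Proof.
apply: (@cvg_lim C^o); first exact: (@norm_hausdorff C C^o).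
have -> : series (fun k => x k * (y k)^* : C^o) =
  (fun n => (series (fun k => y k * (x k)^* : C^o) n)^* : C^o).
  apply/funext => n; rewrite /series/= rmorph_sum/=.
  by apply: eq_bigr => k _; rewrite rmorphM/= conjCK mulrC.
by apply: cvg_conjC; exact: is_cvg_ell2_ip.
Qed.

Lemma ell2_ip_linearr (x : ell2) :
  linear_for (Num.conj \; *%R) (ell2_ip x : ell2 -> C).
Proof.
move=> a u v; rewrite ell2_ip_herm ell2_ip_linearl rmorphD rmorphM/=.
by rewrite -!ell2_ip_herm.
Qed.

Lemma ell2_ip_sqr (x : ell2) :
  ell2_ip x x = (limn (series (fun k => rnorm (x k) ^+ 2)))%:C%C.
Proof.
apply: (@cvg_lim C^o); first exact: (@norm_hausdorff C C^o).
have -> : series (fun k => x k * (x k)^* : C^o) =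
  (fun n => (series (fun k => rnorm (x k) ^+ 2) n)%:C%C : C^o).
  apply/funext => n; rewrite /series/= rmorph_sum/=.
  by apply: eq_bigr => k _; rewrite -normCK rmorphXn/= -rnormE.
by apply: cvg_real_complex; exact: ell2P.
Qed.

Lemma ell2_sum_le (x : ell2) n :
  series (fun k => rnorm (x k) ^+ 2) n <=
  limn (series (fun k => rnorm (x k) ^+ 2)).
Proof.
apply: nondecreasing_cvgn_le; last exact: ell2P.
by apply/nondecreasing_seqP => m; rewrite seriesSr lerDl sqr_ge0.
Qed.

Lemma ell2_ip_gt0 (x : ell2) : x != 0 -> 0 < ell2_ip x x.
Proof.
move=> x0; rewrite ell2_ip_sqr ltcR lt_neqAle.
have k0 k : 0 <= rnorm (x k) ^+ 2 by exact: sqr_ge0.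
rewrite -[leLHS](_ : series (fun k => rnorm (x k) ^+ 2) 0 = 0) ?ell2_sum_le ?andbT; last first.
  by rewrite /series/= big_geq.
apply: contra x0 => /eqP l0; apply/eqP/val_inj/funext => k /=.
have := ell2_sum_le x k.+1; rewrite -l0 seriesSr.
have : 0 <= series (fun k => rnorm (x k) ^+ 2) k by apply: sumr_ge0.
move=> h1 h2; apply: normr0_eq0; rewrite rnormE.
have /eqP : rnorm (x k) ^+ 2 = 0 by apply/eqP; rewrite eq_le k0 andbT; lra.
by rewrite sqrf_eq0 => /eqP ->.
Qed.

HB.instance Definition _ := @bilinear_isBilinear.Build C ell2 ell2 C
  *%R (Num.conj \; *%R) ell2_ip (ell2_ip_linearl, ell2_ip_linearr).
HB.instance Definition _ := @isHermitianSesquilinear.Build C ell2 false Num.conj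
  ell2_ip (fun x y => etrans (ell2_ip_herm x y) (esym (mul1r _))).
HB.instance Definition _ := @isDotProduct.Build C ell2 ell2_ip ell2_ip_gt0.

HB.instance Definition _ := @Lmodule_isNormed.Build C ell2
  (dot_norm ell2_ip) (ler_dot_normD _) (dot_normZ _)
  (@dot_norm0_eq0 _ _ _).

Lemma ell2_sqr_norm (x : ell2) : `|x| ^+ 2 = ell2_ip x x.
Proof. by rewrite sqrtCK. Qed.

Lemma ell2_sqr_rnorm (x : ell2) :
  rnorm x ^+ 2 = limn (series (fun k => rnorm (x k) ^+ 2)).
Proof.
by apply: complexI; rewrite rmorphXn/= -rnormE ell2_sqr_norm ell2_ip_sqr.
Qed.

Lemma ell2_sum_le_rnorm (x : ell2) n :
  series (fun k => rnorm (x k) ^+ 2) n <= rnorm x ^+ 2.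
Proof. by rewrite ell2_sqr_rnorm; exact: ell2_sum_le. Qed.

Lemma ell2_coord_le (x : ell2) k : rnorm (x k) <= rnorm x.
Proof.
rewrite -ler_sqr ?nnegrE ?rnorm_ge0//.
apply: le_trans (ell2_sum_le_rnorm x k.+1); rewrite seriesSr lerDr.
by apply: sumr_ge0 => i _; exact: sqr_ge0.
Qed.

Lemma ell2_complete (F : set_system ell2) :
  ProperFilter F -> cauchy F -> cvg F.
Proof.
move=> PF /cauchyP cF.
have coord_cvg k : cvg ((fun x : ell2 => x k : C^o) @ F).
  apply: complex_complete; apply: cauchy_exP => e e0.
  have [x Fx] := cF e e0; exists (x k); rewrite /=; apply: filterS Fx => y.
  rewrite -!ball_normE/= => xy; apply: le_lt_trans xy.
  by rewrite [leLHS]rnormE [leRHS]rnormE lecR (ell2_coord_le (x - y)).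
pose l k : C := lim ((fun x : ell2 => x k : C^o) @ F).
have lcvg k : (fun x : ell2 => x k : C^o) @ F --> (l k : C^o) by [].
have close (e : R) : 0 < e -> exists x : ell2, F (ball x e%:C%C) /\
    forall n, series (fun k => rnorm (x k - l k) ^+ 2) n <= e ^+ 2.
  move=> e0; have [|x Fx] := cF e%:C%C; first by rewrite ltcR.
  exists x; split=> // n.
  have Fn : (fun z : ell2 => series (fun k => rnorm (x k - z k) ^+ 2) n) @ F
      --> series (fun k => rnorm (x k - l k) ^+ 2) n.
    elim: n => [|n IHn].
      have s0 (u : nat -> R) : series u 0%N = 0 by rewrite /series/= big_geq.
      by rewrite s0; under eq_fun do rewrite s0; exact: cvg_cst.
    rewrite seriesSr; under eq_fun do rewrite seriesSr.
    apply: cvgD => //; apply: cvgM; apply: cvg_rnorm;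
      by apply: (@cvgB C C^o) => //; exact: cvg_cst.
  apply: (cvgr_to_le Fn); apply: filterS Fx => z.
  rewrite -ball_normE/= rnormE ltcR => /ltW xz.
  apply: le_trans (ell2_sum_le_rnorm (x - z) n) _.
  by rewrite ler_sqr ?nnegrE ?rnorm_ge0// ltW.
have lP : l \in sqsummable_pred.
  have [x [_ /= xl]] := close 1 ltr01.
  have xlP : ((x : nat -> C) - l) \in sqsummable_pred.
    by apply/asboolP/sqsummableP; exists (1 ^+ 2).
  have -> : l = (x : nat -> C) - ((x : nat -> C) - l) by rewrite subKr.
  by apply: rpredB => //; exact: valP.
pose L : ell2 := Ell2 lP.
apply/cvg_ex; exists L; apply/cvgrPdist_le => e e0.
have eE : e = (complex.Re e)%:C%C by rewrite RRe_real// gtr0_real.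
have e0' : 0 < complex.Re e / 2 by rewrite divr_gt0// -ltcR -eE.
have [x [Fx xl]] := close _ e0'; apply: filterS Fx => z.
rewrite -ball_normE/= => xz; rewrite -(subrKA x) (le_trans (ler_normD _ _))//.
rewrite [leRHS]eE [complex.Re e]splitr rmorphD; apply: lerD; last exact: ltW.
rewrite distrC rnormE lecR -ler_sqr ?nnegrE ?rnorm_ge0//; last exact: ltW.
rewrite ell2_sqr_rnorm; apply: limr_le; first exact: (@ell2P (x - L)).
by apply: nearW => n; exact: xl.
Qed.

HB.instance Definition _ := Uniform_isComplete.Build ell2 ell2_complete.
HB.instance Definition _ := @isHilbert.Build R ell2 ell2_ip ell2_sqr_norm.
End ell2.

Section operators.
Variable R : realType.
Local Notation C := R[i].
Local Open Scope ereal_scope.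

Definition bounded_ops (H : hilbertType R) : set (H -> H) :=
  [set T | linear T /\ continuous T].

Definition opnorm (H : hilbertType R) (T : H -> H) : \bar R :=
  ereal_sup [set (rnorm (T x))%:E | x in [set x : H | (rnorm x <= 1)%R]].

Definition compact_ops (H : hilbertType R) : set (H -> H) :=
  [set T | bounded_ops T /\
           compact (closure (T @` [set x : H | (rnorm x <= 1)%R]))].

(* The norm of M_n(B(H)) is that of B(H^n), where H^n is the Hilbert space of
   columns xi with norm (sum_i |xi_i|^2)^(1/2). *)
Definition col_norm (H : hilbertType R) n (xi : 'cV[H]_n) : R :=
  Num.sqrt (\sum_i rnorm (xi i ord0) ^+ 2)%R.

Definition mx_apply (H : hilbertType R) n (T : 'M[H -> H]_n) (xi : 'cV[H]_n) :
  'cV[H]_n := (\col_i \sum_j T i j (xi j ord0))%R.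

Definition mx_opnorm (H : hilbertType R) n (T : 'M[H -> H]_n) : \bar R :=
  ereal_sup [set (col_norm (mx_apply T xi))%:E
            | xi in [set xi : 'cV[H]_n | (col_norm xi <= 1)%R]].

Definition is_subspace (V : lmodType C) (E : set V) : Prop :=
  E 0%R /\ forall (a : C) x y, E x -> E y -> E (a *: x + y)%R.

Definition finite_dim (V : lmodType C) (E : set V) : Prop :=
  exists n (b : 'I_n -> V),
    E = [set (\sum_i c i *: b i)%R | c in [set: 'I_n -> C]].

Definition operator_space (H : hilbertType R) (E : set (H -> H)) : Prop :=
  [/\ E `<=` bounded_ops (H := H), is_subspace E &
      forall T, bounded_ops T ->
        (forall e : R, (0 < e)%R -> exists2 S, E S & opnorm (T - S)%R < e%:E) ->
        E T].

(* [u] stands for a map between the subspaces [E] and [F] : only its values on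
   [E] matter. *)
Definition linear_map (V W : lmodType C) (E : set V) (F : set W) (u : V -> W) :
    Prop :=
  {homo u : x / E x >-> F x} /\
  forall (a : C) x y, E x -> E y -> u (a *: x + y)%R = (a *: u x + u y)%R.

Definition cb_norm (H K : hilbertType R) (E : set (H -> H))
    (u : (H -> H) -> (K -> K)) : \bar R :=
  ereal_sup [set a | exists n (T : 'M[H -> H]_n),
    [/\ forall i j, E (T i j), mx_opnorm T <= 1 & a = mx_opnorm (map_mx u T)]].

(* If [E] and [F] are operator spaces, the product 0 * +oo (which is 0) does not
   occur: one of the factors is 0 only if [E] and [F] are both the zero space. *)
Definition d_cb (H K : hilbertType R) (E : set (H -> H)) (F : set (K -> K)) :
    \bar R :=
  ereal_inf [set a | exists (u : (H -> H) -> (K -> K)) (v : (K -> K) -> (H -> H)),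
    [/\ linear_map E F u, linear_map F E v, forall x, E x -> v (u x) = x,
        forall y, F y -> u (v y) = y & a = cb_norm E u * cb_norm F v]].

Definition d_SK_fin (H : hilbertType R) (E : set (H -> H)) : \bar R :=
  ereal_inf [set d_cb E F | F in [set F : set (ell2 R -> ell2 R) |
    operator_space F /\ F `<=` compact_ops (H := ell2 R)]].

(* No closedness is asked of [E] : finite dimensional subspaces are closed. *)
Definition d_SK (H : hilbertType R) (Y : set (H -> H)) : \bar R :=
  ereal_sup [set d_SK_fin E | E in [set E : set (H -> H) |
    [/\ is_subspace E, finite_dim E & E `<=` Y]]].

Definition exact_space (H : hilbertType R) (Y : set (H -> H)) : Prop :=
  d_SK Y < +oo.

(* An operator space structure on the Banach space [X] is a linear isometry [J]
   onto a subspace of some B(H); that subspace is closed because [X] is complete.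
   A map from the operator space [range J] to [F] is [w]; the same map, seen on
   [X], is [w \o J]. The last clause is the isometric identity
   cb(max(X), F) = B(X, F); both sides are +oo for a map outside these spaces. It
   determines the matrix norms of [J], hence max(X) up to complete isometry. *)
Definition is_max (X : completeNormedModType C) (H : hilbertType R)
    (J : X -> (H -> H)) : Prop :=
  [/\ linear J, forall x, bounded_ops (J x),
      forall x, opnorm (J x) = (rnorm x)%:E
    & forall (K : hilbertType R) (F : set (K -> K)) (w : (H -> H) -> (K -> K)),
        operator_space F -> linear_map (range J) F w ->
        cb_norm (range J) w =
        ereal_sup [set opnorm (w (J x)) | x in [set x : X | (rnorm x <= 1)%R]]].

End operators.

(* Main.v *)
Require Import Defs.
From mathcomp Require Import all_boot all_order all_algebra complex.
From mathcomp Require Import classical_sets reals topology normedtype.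
From HB Require Import structures.
From mathcomp Require Import perm finmap.
From mathcomp Require Import boolp functions ereal sequences lra ring zify.

(** Why [max(X)] is not exact.  Let [x_1, ..., x_m] be vectors of the unit ball of
    [X] and suppose that the span [E] of the [J x_j] embeds into the compact
    operators by [u], with inverse [t] and |u|_cb |t|_cb bounded by a constant
    independent of [m].  Put [a_j = u (J x_j)].  As the [J x_j] have norm at most
    one, the row and the column formed by the [a_j] have norm at most
    |u|_cb m^(1/2) ([row_column_bounds]).

    The compact operators are close to matrices of a fixed size, and for matrices
    of a fixed size there are large matrices [q_j] that behave as free generators:
    the norm of sum_j a_j (x) q_j^* is at most a constant times the row-column norm,
    the norm of sum_j c_j q_j is at most 12 times the l2 norm of [c], and yet the
    [q_j] are nearly orthonormal for the normalized trace ([free_tensor_test]).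
    They are built from permutations of a finite group whose Cayley graph looks
    like a tree on a large ball ([involutions_large_girth]).  Moments up to a large
    order are those of the tree, where the operator splits into a part that moves
    away from the root and a part that moves towards it, controlled by the column
    and the row norm ([fsq_tensor_op_supported]).  The norm itself is not controlled
    by the moments, but it is after multiplication by a contraction [p] that is
    close to 1 in normalized Hilbert-Schmidt norm, namely the resolvent of a high
    power of the operator with the small tensor factor traced out ([resolvent_cutoff],
    [asymptotic_free_family]).

    On the other side, the Dvoretzky-Rogers lemma, applied to a quotient of [X] of
    dimension [2m], provides functionals [f_i] with sum_i |f_i (x)|^2 <= |x|^2 and
    vectors [x_j] of the unit ball with Re f_j (x_j) >= 1/2 ([dvoretzky_rogers]).
    The map [x |-> sum_i f_i (x) q_i] has norm at most 12 on [X], so by the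
    universal property of [max(X)] its cb norm is at most 12.  Apply [t] and then
    this map to sum_j a_j (x) q_j^*, and pair the result with the maximally
    entangled vector ([pairing_le]): the near orthonormality of the [q_j] gives a
    quantity of order [m], while the norms give at most a constant times
    m^(1/2) |u|_cb |t|_cb.  This is impossible for large [m]. *)

Set Implicit Arguments.
Unset Strict Implicit.
Unset Printing Implicit Defensive.

(** * Involutions of a finite set with large girth *)

Section Tree.
Variables n L : nat.

Definition reduced (w : seq 'I_n) := sorted (fun i j => i != j) w.

Definition word := {w : L.-bseq 'I_n | reduced w}.

Definition letters (w : word) : seq 'I_n := val (val w).

Lemma letters_inj : injective letters.
Proof. by move=> u v /val_inj/val_inj. Qed.

(** Left multiplication by the generator [j] in the free product of [n] copies of
    Z/2, on reduced words of length at most [L]; words on the boundary of this ball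
    whose image would leave it are fixed. *)
Definition push (j : 'I_n) (w : seq 'I_n) : seq 'I_n :=
  if w is i :: w' then
    if i == j then w' else if size w < L then j :: w else w
  else if 0 < L then [:: j] else [::].

Lemma push_reduced j w :
  (size w <= L) && reduced w -> (size (push j w) <= L) && reduced (push j w).
Proof.
rewrite /reduced; case: w => [|i w] /=; first by case: ifP => //= ->.
move=> /andP[sz so]; have [_|ij] := eqVneq i j.
  by rewrite (ltnW sz) (path_sorted so).
case: ifP => h /=; last by rewrite sz.
by rewrite h eq_sym ij.
Qed.

Lemma pushK j w : (size w <= L) && reduced w -> push j (push j w) = w.
Proof.
rewrite /reduced; case: w => [|i w] /=.
  by case: ifP => h //=; [rewrite eqxx | rewrite h].
move=> /andP[sz so]; have [<-|ij] := eqVneq i j; last first.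
  case: ifP => h /=; first by rewrite eqxx.
  by rewrite (negbTE ij) h.
case: w sz so => [|k w] /=; first by move=> ->.
by move=> sz /andP[]; rewrite eq_sym => /negbTE -> _; rewrite sz.
Qed.

Lemma lettersP (w : word) : (size (letters w) <= L) && reduced (letters w).
Proof. by rewrite size_bseq (valP w). Qed.

Definition push_word j (w : word) : word :=
  let: h := push_reduced j (lettersP w) in
  Sub (Bseq (proj1 (andP h))) (proj2 (andP h)).

Lemma letters_push j w : letters (push_word j w) = push j (letters w).
Proof. by []. Qed.

Lemma push_wordK j : involutive (push_word j).
Proof. by move=> w; apply: letters_inj; rewrite !letters_push pushK ?lettersP. Qed.

Definition push_perm j : {perm word} := perm (inv_inj (push_wordK j)).

Definition root_word : word := Sub (Bseq (leq0n L : size [::] <= L)) isT.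

Lemma size_push j w : size w < L ->
  size (push j w) = (size w).+1 \/ size w = (size (push j w)).+1.
Proof.
case: w => [|i w] /=; first by move=> ->; left.
by move=> ->; case: ifP => _; [right | left].
Qed.

Lemma push_shrink j w : size (push j w) < size w -> ohead w = Some j.
Proof.
case: w => [|i w] //=; have [->//|_] := eqVneq i j.
by case: ifP => /= _; rewrite ?ltnn // ltnNge leqnSn.
Qed.

End Tree.

(** The points are the permutations of the ball of radius [L] in the free product
    of [n] copies of Z/2, and the generators act by multiplication.  Evaluation at
    the root maps this finite graph onto the ball, and after a translation any point
    [g] can be sent to the root; [d] is the word length pulled back along this map.
    So every point sees a height function with the local behaviour of a tree: below
    height [L] each generator changes the height by one, and at most one generator
    decreases it. *)
Lemma involutions_large_girth (n L : nat) :
  exists k (s : 'I_n -> 'I_k.+1 -> 'I_k.+1),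
    (forall j, involutive (s j)) /\
    forall g, exists d : 'I_k.+1 -> nat, [/\ d g = 0,
      forall h j, d h < L -> d (s j h) = (d h).+1 \/ d h = (d (s j h)).+1 &
      forall h i j, d (s i h) < d h -> d (s j h) < d h -> i = j].
Proof.
pose T := {perm word n L}.
have [k kT] : exists k, #|{: T}| = k.+1.
  by case: #|_| (fintype0 (1%g : T)) => [/(_ erefl)//|k _]; exists k.
pose e (x : T) : 'I_k.+1 := cast_ord kT (enum_rank x).
pose f (i : 'I_k.+1) : T := enum_val (cast_ord (esym kT) i).
have eK : cancel e f by move=> x; rewrite /f /e cast_ordK enum_rankK.
have fK : cancel f e by move=> x; rewrite /f /e enum_valK cast_ordKV.
exists k, (fun j i => e (f i * push_perm L j)%g); split.
  move=> j i; rewrite eK -mulgA (_ : push_perm L j * _ = 1)%g ?mulg1 ?fK //.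
  by apply/permP => w; rewrite permM !permE push_wordK.
move=> g; exists (fun h => size (letters (((f g)^-1 * f h)%g (root_word n L)))).
have step h j : letters (((f g)^-1 * f (e (f h * push_perm L j)))%g (root_word n L)) =
    push L j (letters (((f g)^-1 * f h)%g (root_word n L))).
  by rewrite eK mulgA permM permE letters_push.
split=> [|h j|h i j].
- by rewrite mulVg perm1.
- by rewrite step; exact: size_push.
- by rewrite !step => /push_shrink hi /push_shrink; rewrite hi => -[].
Qed.

(** * The real inner product of complex matrices *)

Import Order.TTheory GRing.Theory Num.Theory.
Import numFieldNormedType.Exports.
Local Open Scope classical_set_scope.
Local Open Scope ring_scope.

Section RealDot.
Variable R : realType.
Local Notation C := R[i].

Definition cdot (z w : C) : R :=
  complex.Re z * complex.Re w + complex.Im z * complex.Im w.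

Lemma cdotC z w : cdot z w = cdot w z.
Proof. by rewrite /cdot; ring. Qed.

Lemma cdotDl z z' w : cdot (z + z') w = cdot z w + cdot z' w.
Proof. by case: z z' => [a b] [c d]; rewrite /cdot /=; ring. Qed.

Lemma cdot0l w : cdot 0 w = 0.
Proof. by rewrite /cdot /=; ring. Qed.

Lemma cdot_suml I (r : seq I) (P : pred I) (F : I -> C) w :
  cdot (\sum_(i <- r | P i) F i) w = \sum_(i <- r | P i) cdot (F i) w.
Proof. by apply: (big_morph (cdot^~ w)) => [z z'|]; rewrite ?cdotDl ?cdot0l. Qed.

Lemma cdot_sumr I (r : seq I) (P : pred I) (F : I -> C) w :
  cdot w (\sum_(i <- r | P i) F i) = \sum_(i <- r | P i) cdot w (F i).
Proof. by rewrite cdotC cdot_suml; apply: eq_bigr => i _; rewrite cdotC. Qed.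

Lemma cdotM (c z w : C) : cdot (c * z) w = cdot z (c^* * w).
Proof. by case: c z w => [a b] [c d] [e f]; rewrite /cdot /=; ring. Qed.

Lemma cdotzz z : cdot z z = rnorm z ^+ 2.
Proof.
by rewrite /rnorm normc_def /= sqr_sqrtr ?addr_ge0 ?sqr_ge0.
Qed.

Lemma rnormZ (V : normedModType C) (a : C) (x : V) :
  rnorm (a *: x) = rnorm a * rnorm x.
Proof. by apply: complexI; rewrite rmorphM /= -!rnormE normrZ. Qed.

Lemma rnorm_real (r : R) : rnorm (r%:C)%C = `|r|.
Proof. by rewrite /rnorm normc_def /= expr0n addr0 sqrtr_sqr. Qed.

Lemma conj_real (r : R) : ((r%:C)%C : C)^* = (r%:C)%C.
Proof. by apply/eqP; rewrite eq_complex /= oppr0 !eqxx. Qed.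

(** The real part of tr (A B^* ).  A real inner product is all that the norm
    estimates need, and it keeps the inequalities in a totally ordered field. *)
Definition rdot p q (A B : 'M[C]_(p, q)) : R := \sum_i \sum_j cdot (A i j) (B i j).
(** The square of the Hilbert-Schmidt norm. *)
Definition fsq p q (A : 'M[C]_(p, q)) : R := rdot A A.
Definition adj p q (A : 'M[C]_(p, q)) : 'M[C]_(q, p) := (map_mx Num.conj A)^T.

Section Dims.
Variables p q : nat.
Implicit Types A B D : 'M[C]_(p, q).

Lemma rdotC A B : rdot A B = rdot B A.
Proof. by apply: eq_bigr => i _; apply: eq_bigr => j _; rewrite cdotC. Qed.

Lemma rdotDl A B D : rdot (A + B) D = rdot A D + rdot B D.
Proof.
rewrite -big_split /=; apply: eq_bigr => i _; rewrite -big_split /=.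
by apply: eq_bigr => j _; rewrite !mxE cdotDl.
Qed.

Lemma rdotDr D A B : rdot D (A + B) = rdot D A + rdot D B.
Proof. by rewrite rdotC rdotDl !(rdotC D). Qed.

Lemma rdot0l A : rdot 0 A = 0.
Proof. by rewrite /rdot big1 // => i _; rewrite big1 // => j _; rewrite mxE cdot0l. Qed.

Lemma rdot_suml I (r : seq I) (P : pred I) (F : I -> 'M[C]_(p, q)) A :
  rdot (\sum_(i <- r | P i) F i) A = \sum_(i <- r | P i) rdot (F i) A.
Proof. exact: (big_morph (fun B => rdot B A) (fun x y => rdotDl x y A) (rdot0l A)). Qed.

Lemma rdot_sumr I (r : seq I) (P : pred I) (F : I -> 'M[C]_(p, q)) A :
  rdot A (\sum_(i <- r | P i) F i) = \sum_(i <- r | P i) rdot A (F i).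
Proof. by rewrite rdotC rdot_suml; apply: eq_bigr => i _; rewrite rdotC. Qed.

Lemma rdotZl (c : C) A B : rdot (c *: A) B = rdot A (c^* *: B).
Proof. by apply: eq_bigr => i _; apply: eq_bigr => j _; rewrite !mxE cdotM. Qed.

Lemma rdotRl (r : R) A B : rdot ((r%:C)%C *: A) B = r * rdot A B.
Proof.
rewrite /rdot mulr_sumr; apply: eq_bigr => i _; rewrite mulr_sumr.
apply: eq_bigr => j _; rewrite mxE /cdot.
by case: (A i j) (B i j) => [a b] [c d] /=; ring.
Qed.

Lemma rdotNl A B : rdot (- A) B = - rdot A B.
Proof. by have := rdotDl (- A) A B; rewrite addNr rdot0l => /eqP; rewrite eq_sym addr_eq0 => /eqP. Qed.

Lemma rdotNr A B : rdot A (- B) = - rdot A B.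
Proof. by rewrite rdotC rdotNl rdotC. Qed.

Lemma fsqE A : fsq A = \sum_i \sum_j rnorm (A i j) ^+ 2.
Proof. by apply: eq_bigr => i _; apply: eq_bigr => j _; rewrite cdotzz. Qed.

Lemma fsq_ge0 A : 0 <= fsq A.
Proof. by rewrite fsqE; apply: sumr_ge0 => i _; apply: sumr_ge0 => j _; exact: sqr_ge0. Qed.

Lemma fsq0 : fsq (0 : 'M[C]_(p, q)) = 0.
Proof. exact: rdot0l. Qed.

Lemma fsqD A B : fsq (A + B) = fsq A + 2 * rdot A B + fsq B.
Proof. by rewrite /fsq rdotDl !rdotDr (rdotC B A); ring. Qed.

Lemma fsqN A : fsq (- A) = fsq A.
Proof. by rewrite /fsq rdotNl rdotNr opprK. Qed.

Lemma fsqB A B : fsq (A - B) = fsq A - 2 * rdot A B + fsq B.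
Proof. by rewrite fsqD fsqN rdotNr; ring. Qed.

Lemma rdot_le A B : 2 * rdot A B <= fsq A + fsq B.
Proof. by have := fsq_ge0 (A - B); rewrite fsqB; lra. Qed.

Lemma fsqD_le A B : fsq (A + B) <= 2 * fsq A + 2 * fsq B.
Proof. by have := rdot_le A B; rewrite fsqD; lra. Qed.

Lemma fsqZ (c : C) A : fsq (c *: A) = rnorm c ^+ 2 * fsq A.
Proof.
rewrite !fsqE mulr_sumr; apply: eq_bigr => i _; rewrite mulr_sumr.
by apply: eq_bigr => j _; rewrite mxE rnormM exprMn.
Qed.

Lemma fsqR (r : R) A : fsq ((r%:C)%C *: A) = r ^+ 2 * fsq A.
Proof. by rewrite fsqZ rnorm_real real_normK ?num_real. Qed.

Lemma rdot_CS A B : rdot A B ^+ 2 <= fsq A * fsq B.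
Proof.
(* The discriminant of this nonnegative quadratic polynomial in t. *)
have key (t : R) : 0 <= fsq A * t ^+ 2 - 2 * rdot A B * t + fsq B.
  by have := fsq_ge0 ((t%:C)%C *: A - B); rewrite fsqB fsqR rdotRl; lra.
have [A0|A0] := eqVneq (fsq A) 0.
  have [->|r0] := eqVneq (rdot A B) 0; first by rewrite A0; lra.
  have := key ((fsq B + 1) / (2 * rdot A B)); rewrite A0.
  have -> : 2 * rdot A B * ((fsq B + 1) / (2 * rdot A B)) = fsq B + 1 by field.
  lra.
have A1 : 0 < fsq A by rewrite lt_neqAle eq_sym A0 fsq_ge0.
have := key (rdot A B / fsq A).
have -> : fsq A * (rdot A B / fsq A) ^+ 2 - 2 * rdot A B * (rdot A B / fsq A) +
  fsq B = (fsq A * fsq B - rdot A B ^+ 2) / fsq A by field.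
by rewrite pmulr_lge0 ?invr_gt0 // subr_ge0.
Qed.

(** The Cauchy-Schwarz inequality, by summing [rdot_le] over all pairs. *)
Lemma fsq_sum (I : finType) (F : I -> 'M[C]_(p, q)) :
  fsq (\sum_i F i) <= #|I|%:R * \sum_i fsq (F i).
Proof.
have le2 : 2 * fsq (\sum_i F i) <= \sum_i \sum_j (fsq (F i) + fsq (F j)).
  rewrite {1}/fsq rdot_suml mulr_sumr; apply: ler_sum => i _.
  by rewrite rdot_sumr mulr_sumr; apply: ler_sum => j _; exact: rdot_le.
have : \sum_i \sum_j (fsq (F i) + fsq (F j)) = 2 * (#|I|%:R * \sum_i fsq (F i)).
  under eq_bigr do rewrite big_split /= sumr_const -mulr_natl.
  by rewrite big_split /= sumr_const -mulr_sumr -mulr_natl; ring.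
lra.
Qed.

Lemma fsq_row A : fsq A = \sum_i fsq (row i A).
Proof.
apply: eq_bigr => i _; rewrite /fsq /rdot big_ord1.
by apply: eq_bigr => j _; rewrite !mxE.
Qed.

Lemma fsq_col A : fsq A = \sum_j fsq (col j A).
Proof.
rewrite /fsq /rdot exchange_big /=; apply: eq_bigr => j _.
by apply: eq_bigr => i _; rewrite big_ord1 !mxE.
Qed.

End Dims.

Lemma rdot_mulmxl p q r (a : 'M[C]_(p, q)) (A : 'M[C]_(q, r)) (B : 'M[C]_(p, r)) :
  rdot (a *m A) B = rdot A (adj a *m B).
Proof.
rewrite /rdot.
under eq_bigr => i _ do under eq_bigr => j _ do rewrite mxE cdot_suml.
under eq_bigr => i _ do rewrite exchange_big /=.
rewrite exchange_big /=; apply: eq_bigr => j _; rewrite exchange_big /=.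
apply: eq_bigr => k _; rewrite mxE cdot_sumr; apply: eq_bigr => i _.
by rewrite cdotM !mxE.
Qed.

Lemma rdot_mulmxr p q r (A : 'M[C]_(p, q)) (b : 'M[C]_(q, r)) (B : 'M[C]_(p, r)) :
  rdot (A *m b) B = rdot A (B *m adj b).
Proof.
rewrite /rdot; apply: eq_bigr => i _.
under eq_bigr => j _ do rewrite mxE cdot_suml.
rewrite exchange_big /=; apply: eq_bigr => j _.
rewrite mxE cdot_sumr; apply: eq_bigr => k _.
by rewrite mulrC cdotM !mxE mulrC.
Qed.

Lemma adjK p q (A : 'M[C]_(p, q)) : adj (adj A) = A.
Proof. by apply/matrixP => i j; rewrite !mxE conjCK. Qed.

Lemma adjM p q r (A : 'M[C]_(p, q)) (B : 'M[C]_(q, r)) : adj (A *m B) = adj B *m adj A.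
Proof. by rewrite /adj map_mxM trmx_mul. Qed.

Lemma fsq_adj p q (A : 'M[C]_(p, q)) : fsq (adj A) = fsq A.
Proof.
rewrite !fsqE exchange_big /=; apply: eq_bigr => i _; apply: eq_bigr => j _.
by rewrite !mxE rnorm_conj.
Qed.

Lemma fsq_conj p q (A : 'M[C]_(p, q)) : fsq (map_mx Num.conj A) = fsq A.
Proof.
rewrite !fsqE; apply: eq_bigr => i _; apply: eq_bigr => j _.
by rewrite !mxE rnorm_conj.
Qed.

End RealDot.

(** * Moments of tensors with tree-like permutations *)

Section Moments.
Variable R : realType.
Local Notation C := R[i].

(** The column and the row formed by the matrices [a j] are contractions. *)
Definition rc_contraction N n (a : 'I_n -> 'M[C]_N) : Prop :=
  (forall v : 'cV[C]_N, \sum_j fsq (a j *m v) <= fsq v) /\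
  (forall v : 'I_n -> 'cV[C]_N, fsq (\sum_j a j *m v j) <= \sum_j fsq (v j)).

(** Both bounds follow by duality: pair with the vector to be estimated and absorb
    half of its square by the inequality [rdot_le]. *)
Lemma rc_contraction_adj N n (a : 'I_n -> 'M[C]_N) :
  rc_contraction a -> rc_contraction (fun j => adj (a j)).
Proof.
move=> [ca ra]; split=> [u|v].
  have := rdot_le (\sum_j a j *m (adj (a j) *m u)) u.
  rewrite rdot_suml; under eq_bigr do rewrite rdot_mulmxl.
  by have := ra (fun j => adj (a j) *m u); rewrite /fsq; lra.
set u := \sum_j _; have : 2 * fsq u <= \sum_j (fsq (v j) + fsq (a j *m u)).
  rewrite {1}/fsq {1}/u rdot_suml mulr_sumr; apply: ler_sum => j _.
  by rewrite rdot_mulmxl adjK; exact: rdot_le.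
by rewrite big_split /=; have := ca u; lra.
Qed.

Lemma sum_at_most_one (I : finType) (P : pred I) (F : I -> R) (c : R) :
  (forall i j, P i -> P j -> i = j) -> 0 <= c -> (forall i, P i -> F i <= c) ->
  \sum_(i | P i) F i <= c.
Proof.
move=> P1 c0 Fc; have [i Pi|P0] := pickP P; last by rewrite big_pred0.
rewrite (bigD1 i) //= big1 ?addr0 ?Fc // => j /andP[Pj]; rewrite (P1 _ _ Pj Pi).
by rewrite eqxx.
Qed.

Lemma fsq_sum_at_most_one (I : finType) (P : pred I) p q (F : I -> 'M[C]_(p, q)) :
  (forall i j, P i -> P j -> i = j) ->
  fsq (\sum_(i | P i) F i) = \sum_(i | P i) fsq (F i).
Proof.
move=> P1; have [i Pi|P0] := pickP P; last by rewrite !big_pred0 ?fsq0.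
have E j : P j = (j == i).
  by apply/idP/eqP => [Pj|->//]; exact: P1.
by under eq_bigl do rewrite E; under [RHS]eq_bigl do rewrite E; rewrite !big_pred1_eq.
Qed.

Section TensorOperator.
Variables (N n k : nat) (s : 'I_n -> 'I_k -> 'I_k).
Hypothesis sK : forall j, involutive (s j).
Implicit Types (a : 'I_n -> 'M[C]_N) (z : 'M[C]_(N, k)).

(** The operator sum_j a_j (x) U_j, where U_j is the permutation matrix of [s j];
    a vector of the tensor product C^N (x) C^k is written as an N x k matrix. *)
Definition tensor_op a z : 'M[C]_(N, k) := \sum_j a j *m colsub (s j) z.

Lemma tensor_op_is_linear a : linear (tensor_op a).
Proof.
move=> c u v; rewrite /tensor_op scaler_sumr -big_split /=; apply: eq_bigr => j _.
rewrite scalemxAr -mulmxDr; congr (_ *m _).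
by apply/matrixP => x y; rewrite !mxE.
Qed.
HB.instance Definition _ a :=
  GRing.isLinear.Build C 'M[C]_(N, k) 'M[C]_(N, k) _ (tensor_op a) (tensor_op_is_linear a).

Lemma col_tensor_op a z h : col h (tensor_op a z) = \sum_j a j *m col (s j h) z.
Proof.
rewrite /tensor_op; apply/matrixP => x y; rewrite !mxE summxE summxE.
by apply: eq_bigr => j _; rewrite !mxE; apply: eq_bigr => l _; rewrite !mxE.
Qed.

Lemma rdot_colsub j z z' : rdot (colsub (s j) z) z' = rdot z (colsub (s j) z').
Proof.
apply: eq_bigr => x _; rewrite (reindex_inj (inv_inj (sK j))) /=.
by apply: eq_bigr => y _; rewrite !mxE sK.
Qed.

Lemma rdot_tensor_op a z z' : rdot (tensor_op a z) z' = rdot z (tensor_op (fun j => adj (a j)) z').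
Proof.
rewrite /tensor_op rdot_suml rdot_sumr; apply: eq_bigr => j _.
rewrite rdot_mulmxl rdot_colsub; congr (rdot z _).
by apply/matrixP => x y; rewrite !mxE; apply: eq_bigr => i _; rewrite !mxE.
Qed.

Definition tensor_sq a z := tensor_op (fun j => adj (a j)) (tensor_op a z).

Lemma rdot_tensor_sq a z z' : rdot (tensor_sq a z) z' = rdot z (tensor_sq a z').
Proof.
rewrite /tensor_sq rdot_tensor_op [in RHS]rdotC rdot_tensor_op [in RHS]rdotC.
rewrite (_ : (fun j => adj (adj (a j))) = a) //.
by apply/funext => j; rewrite adjK.
Qed.

Lemma rdot_tensor_sq_diag a z : rdot (tensor_sq a z) z = fsq (tensor_op a z).
Proof.
rewrite /tensor_sq rdot_tensor_op (_ : (fun j => adj (adj (a j))) = a) //.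
by apply/funext => j; rewrite adjK.
Qed.

Definition tensor_pow a q z := iter q (tensor_sq a) z.

Lemma tensor_pow_is_linear a q : linear (tensor_pow a q).
Proof.
elim: q => [//|q IH] c u v.
by rewrite /tensor_pow !iterS -!/(tensor_pow _ _ _) IH /tensor_sq !linearP.
Qed.
HB.instance Definition _ a q :=
  GRing.isLinear.Build C 'M[C]_(N, k) 'M[C]_(N, k) _ (tensor_pow a q)
    (tensor_pow_is_linear a q).

Lemma rdot_tensor_pow a q z z' : rdot (tensor_pow a q z) z' = rdot z (tensor_pow a q z').
Proof.
elim: q z z' => [//|q IH] z z'.
by rewrite {1}/tensor_pow iterSr -/(tensor_pow _ _ _) IH rdot_tensor_sq.
Qed.

(** Log-convexity of the moments of the positive operator [x^* x]: repeated squaring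
    of the Cauchy-Schwarz inequality bounds the norm of [x z] by a moment of order
    2^t. *)
Lemma fsq_tensor_op_le_pow a t z :
  fsq (tensor_op a z) ^+ (2 ^ t.+1) <=
  fsq (tensor_pow a (2 ^ t) z) * fsq z ^+ (2 ^ t.+1).-1.
Proof.
elim: t => [|t IH].
  rewrite expr1 expn1 -rdot_tensor_sq_diag; exact: rdot_CS.
have e2 : (2 ^ t.+2).-1 = ((2 ^ t.+1).-1 * 2).+1.
  by have := expn_gt0 2 t.+1; rewrite (expnS 2 t.+1); lia.
rewrite [X in _ ^+ X <= _]expnSr exprM e2 (exprS (fsq z)) (exprM (fsq z)).
apply: (@le_trans _ _ ((fsq (tensor_pow a (2 ^ t) z) * fsq z ^+ (2 ^ t.+1).-1) ^+ 2)).
  by rewrite ler_sqr ?nnegrE ?mulr_ge0 ?exprn_ge0 ?fsq_ge0.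
rewrite exprMn mulrA ler_wpM2r ?exprn_ge0 ?fsq_ge0 //.
rewrite expnSr muln2 -addnn /tensor_pow iterD -/(tensor_pow _ _ _) -/(tensor_pow _ _ _).
rewrite {1}/fsq rdot_tensor_pow [leRHS]mulrC; exact: rdot_CS.
Qed.

Section Height.
Variables (L : nat) (d : 'I_k -> nat).
Hypothesis d_step : forall h j, (d h < L)%N ->
  d (s j h) = (d h).+1 \/ d h = (d (s j h)).+1.
Hypothesis d_parent : forall h i j, (d (s i h) < d h)%N -> (d (s j h) < d h)%N -> i = j.

Definition supported (i : nat) z := forall h, (i < d h)%N -> col h z = 0.

Lemma supported_tensor_op a i z : (i < L)%N -> supported i z -> supported i.+1 (tensor_op a z).
Proof.
move=> iL sz h dh; rewrite col_tensor_op big1 // => j _; rewrite sz ?mulmx0 //.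
rewrite ltnNge; apply/negP => le_i.
by have := d_step j (leq_ltn_trans le_i iL); rewrite sK; lia.
Qed.

(** Split the operator according to whether the height grows or decreases at the
    target.  Towards the larger heights each point receives from one neighbour only,
    so the column bound applies; towards the smaller ones each point sends to one
    neighbour only, so the row bound applies.  Both parts are contractions. *)
Lemma fsq_tensor_op_supported a i z : rc_contraction a -> (i < L)%N -> supported i z ->
  fsq (tensor_op a z) <= 4 * fsq z.
Proof.
move=> [ca ra] iL sz; pose P h j := (d (s j h) < d h)%N.
pose up := \matrix_(x, h) (\sum_(j | P h j) a j *m col (s j h) z) x ord0.
pose dn := \matrix_(x, h) (\sum_(j | ~~ P h j) a j *m col (s j h) z) x ord0.
have colup h : col h up = \sum_(j | P h j) a j *m col (s j h) z.
  by apply/matrixP => x y; rewrite !mxE (ord1 y).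
have coldn h : col h dn = \sum_(j | ~~ P h j) a j *m col (s j h) z.
  by apply/matrixP => x y; rewrite !mxE (ord1 y).
have -> : tensor_op a z = up + dn.
  apply/matrixP => x h; have /matrixP/(_ x ord0) := col_tensor_op a z h.
  rewrite (bigID (P h)) /= => E.
  by move: E; rewrite mxE => ->; rewrite !mxE.
have fup : fsq up <= fsq z.
  rewrite !fsq_col; under eq_bigr => h _.
    rewrite colup fsq_sum_at_most_one; last by move=> i1 i2; exact: d_parent.
    over.
  apply: (@le_trans _ _ (\sum_h \sum_j fsq (a j *m col (s j h) z))).
    apply: ler_sum => h _; rewrite [leRHS](bigID (P h)) /= lerDl.
    by apply: sumr_ge0 => j _; exact: fsq_ge0.
  rewrite exchange_big /=; under eq_bigr => j _.
    rewrite (reindex_inj (inv_inj (sK j))) /=; under eq_bigr do rewrite sK; over.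
  by rewrite exchange_big /=; apply: ler_sum => h _; exact: ca.
have fdn : fsq dn <= fsq z.
  rewrite !fsq_col.
  apply: (@le_trans _ _ (\sum_h \sum_j (if ~~ P h j then fsq (col (s j h) z) else 0))).
    apply: ler_sum => h _; rewrite coldn.
    pose v j := if ~~ P h j then col (s j h) z else 0.
    have -> : \sum_(j | ~~ P h j) a j *m col (s j h) z = \sum_j a j *m v j.
      by rewrite big_mkcond; apply: eq_bigr => j _; rewrite /v; case: ifP; rewrite ?mulmx0.
    apply: le_trans (ra v) _; apply: ler_sum => j _.
    by rewrite /v; case: ifP; rewrite ?fsq0.
  rewrite exchange_big /=; under eq_bigr => j _.
    rewrite (reindex_inj (inv_inj (sK j))) /=; under eq_bigr do rewrite sK; over.
  rewrite exchange_big /=; apply: ler_sum => h _; rewrite -big_mkcond /=.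
  have [ih|hi] := ltnP i (d h).
    by rewrite (sz _ ih) fsq0 big1.
  apply: sum_at_most_one => [j1 j2| |//]; last exact: fsq_ge0.
  rewrite /P !sK => n1 n2; apply: (@d_parent h).
    by have := d_step j1 (leq_ltn_trans hi iL); lia.
  by have := d_step j2 (leq_ltn_trans hi iL); lia.
by have := fsqD_le up dn; lra.
Qed.

(** Each application raises the height of the support by one, so that [2 q] of them
    starting at the root never see the boundary of the tree. *)
Lemma fsq_tensor_pow_supported a q z : rc_contraction a -> (q.*2 <= L)%N ->
  supported 0 z -> fsq (tensor_pow a q z) <= 16 ^+ q * fsq z.
Proof.
move=> ra qL sz; suff: supported q.*2 (tensor_pow a q z) /\
  fsq (tensor_pow a q z) <= 16 ^+ q * fsq z by case.
elim: q qL => [|q IH] qL; first by rewrite expr0 mul1r.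
have [|s1 f1] := IH; first by lia.
have q1 : (q.*2 < L)%N by lia.
have q2 : (q.*2.+1 < L)%N by lia.
have s2 := supported_tensor_op a q1 s1.
rewrite /tensor_pow iterS -/(tensor_pow _ _ _) /tensor_sq; split.
  by rewrite doubleS; apply: supported_tensor_op => //; lia.
have := fsq_tensor_op_supported ra q1 s1.
have := fsq_tensor_op_supported (rc_contraction_adj ra) q2 s2.
by rewrite exprS; lra.
Qed.

End Height.
End TensorOperator.
End Moments.

(** * From moments to norms: the resolvent cutoff *)

Section ResolventCutoff.
Variable R : realType.
Local Notation C := R[i].

Lemma fsq_eq0 p q (A : 'M[C]_(p, q)) : fsq A = 0 -> A = 0.
Proof.
rewrite fsqE => /eqP; rewrite psumr_eq0 => [/allP A0|i _]; last first.
  by apply: sumr_ge0 => j _; exact: sqr_ge0.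
apply/matrixP => i j; rewrite mxE; have := A0 i (mem_index_enum _) => /=.
rewrite psumr_eq0 => [/allP /(_ j (mem_index_enum _)) /=|l _]; last exact: sqr_ge0.
by rewrite sqrf_eq0 => /eqP Aij; apply: normr0_eq0; rewrite rnormE Aij.
Qed.

(** Take p = (1 + B)^-1 for the positive matrix B = sum_t F_t F_t^*.  It is a smooth
    version of the spectral projection of [B] on [0, 1]: if w = z p then z = w + w B,
    and expanding the square norm gives all three bounds.  The trace of [B] is the
    right hand side of the last one. *)
Lemma resolvent_cutoff (T : finType) k l (F : T -> 'M[C]_(k, l)) :
  exists p : 'M[C]_k, [/\
    forall q (z : 'M[C]_(q, k)), fsq (z *m p) <= fsq z,
    forall q (z : 'M[C]_(q, k)), \sum_t fsq (z *m p *m F t) <= fsq z &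
    fsq (1%:M - p) <= \sum_t fsq (F t)].
Proof.
pose B := \sum_t F t *m adj (F t).
have rB q (z w : 'M[C]_(q, k)) :
    rdot (z *m B) w = \sum_t rdot (z *m F t) (w *m F t).
  rewrite /B mulmx_sumr rdot_suml; apply: eq_bigr => t _.
  by rewrite mulmxA rdot_mulmxr adjK.
have fB q (z : 'M[C]_(q, k)) : rdot (z *m B) z = \sum_t fsq (z *m F t) by rewrite rB.
have fB0 q (z : 'M[C]_(q, k)) : 0 <= \sum_t fsq (z *m F t).
  by apply: sumr_ge0 => t _; exact: fsq_ge0.
have expand q (z : 'M[C]_(q, k)) : fsq (z *m (1%:M + B)) =
    fsq z + 2 * \sum_t fsq (z *m F t) + fsq (z *m B).
  by rewrite mulmxDr mulmx1 fsqD rdotC fB.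
have uB : (1%:M + B) \in unitmx.
  rewrite -row_free_unit; apply: inj_row_free => v v0.
  apply: fsq_eq0; have := expand _ v; rewrite v0 fsq0.
  by have := fB0 _ v; have := fsq_ge0 v; have := fsq_ge0 (v *m B); lra.
exists (invmx (1%:M + B)).
have E q (z : 'M[C]_(q, k)) : z = z *m invmx (1%:M + B) *m (1%:M + B).
  by rewrite mulmxKV.
split=> [q z|q z|].
- set w := z *m _; rewrite [X in _ <= fsq X]E -/w expand.
  by have := fB0 _ w; have := fsq_ge0 (w *m B); lra.
- set w := z *m _; rewrite [X in _ <= fsq X]E -/w expand.
  by have := fB0 _ w; have := fsq_ge0 (w *m B); have := fsq_ge0 w; lra.
set p := invmx _; have Ep := E _ 1%:M; rewrite mul1mx -/p in Ep.
have -> : 1%:M - p = p *m B by rewrite Ep mulmxDr mulmx1 addrC addKr.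
have -> : \sum_t fsq (F t) = rdot (1%:M *m B) 1%:M.
  by rewrite fB; apply: eq_bigr => t _; rewrite mul1mx.
rewrite Ep mulmxDr mulmx1 mulmxDl !rdotDl !rdotDr fB -/(fsq (p *m B)).
rewrite [rdot (p *m B *m B) p](_ : _ = fsq (p *m B)); last first.
  by rewrite rB /fsq rB; apply: eq_bigr => t _; rewrite rdotC.
rewrite fB; have := fB0 _ p; have := fB0 _ (p *m B).
by have := fsq_ge0 (p *m B); lra.
Qed.

Lemma fsq_mxvec p q (A : 'M[C]_(p, q)) : fsq (mxvec A) = fsq A.
Proof.
rewrite !fsqE big_ord1 pair_bigA /=.
rewrite (reindex _ (curry_mxvec_bij p q)) /=.
by apply: eq_bigr => -[i j] _ /=; rewrite mxvecE.
Qed.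

Lemma fsq_delta p q (i : 'I_p) (j : 'I_q) : fsq (delta_mx i j : 'M[C]_(p, q)) = 1.
Proof.
rewrite fsqE (bigD1 i) //= [X in _ + X]big1 => [|i' ii']; last first.
  by apply: big1 => j' _; rewrite mxE (negbTE ii') /rnorm normr0 expr0n.
rewrite (bigD1 j) //= big1 => [|j' jj']; last first.
  by rewrite mxE (negbTE jj') andbF /rnorm normr0 expr0n.
by rewrite mxE !eqxx /rnorm normr1 /= expr1n !addr0.
Qed.

Lemma exists_large_pow (x : R) : exists t : nat, x <= 4 ^+ (2 ^ t).
Proof.
exists (Num.bound `|x|); apply: (le_trans (ler_norm x)).
apply: (le_trans (ltW (archi_boundP (normr_ge0 x)))).
rewrite -natrX ler_nat; set b := Num.bound _.
apply: (leq_trans (ltnW (ltn_expl b (isT : 1 < 2)%N))).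
by apply: (leq_trans (ltnW (ltn_expl _ (isT : 1 < 4)%N))).
Qed.

(** Let y = x^* x for x = sum_j a_j (x) U_j.  Averaged over the points of the large
    permutation space, the moment of order [2 Q] of [x] is at most 4^Q in norm,
    because every point is the root of a tree.  Divided by 8^Q it is small, and
    [resolvent_cutoff] turns it into a contraction [p], close to 1, such that
    y^Q (1 (x) p) has norm at most 8^Q up to the factor N^(1/2).  As [Q] is large
    compared with the fixed size [N], taking the root of order [Q] absorbs this
    factor.  A finite family is treated with a single [p]. *)
Lemma asymptotic_free_family N n (T : finType) (a : T -> 'I_n -> 'M[C]_N) (e : R) :
  (forall t, rc_contraction (a t)) -> 0 < e ->
  exists k (s : 'I_n -> 'I_k.+1 -> 'I_k.+1) (p : 'M[C]_k.+1), [/\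
    forall j, involutive (s j),
    forall i j h, s i h = s j h -> i = j,
    forall q (z : 'M[C]_(q, k.+1)), fsq (z *m p) <= fsq z,
    fsq (1%:M - p) <= e * k.+1%:R &
    forall t z, fsq (tensor_op s (a t) (z *m p)) <= 16 * fsq z].
Proof.
move=> ra e0.
(* 4 ^ Q dominates both the size N, for the root of order Q, and N |T| / e, for the
   trace of the cutoff. *)
have [t0 ht0] := exists_large_pow (N%:R + (#|T| * N)%:R / e).
set Q := (2 ^ t0)%N in ht0.
have Q0 : (0 < Q)%N by rewrite expn_gt0.
have cN : (N%:R : R) <= 4 ^+ Q.
  by apply: le_trans ht0; rewrite lerDl divr_ge0 ?ler0n // ltW.
have ce : ((#|T| * N)%:R : R) <= e * 4 ^+ Q.
  rewrite mulrC -ler_pdivrMr //; apply: le_trans ht0; rewrite lerDr ?ler0n //.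
have [k [s [sK hs]]] := involutions_large_girth n Q.*2.
(* The matrix of v |-> y^Q (e_r (x) v), for the basis vectors e_r of the small factor. *)
pose f (x : T * 'I_N) : 'rV[C]_k.+1 -> 'rV[C]_(N * k.+1) :=
  mxvec \o (tensor_pow s (a x.1) Q \o mulmx (delta_mx x.2 0 : 'cV[C]_N)).
pose c : R := (8 ^+ Q)^-1.
pose F x : 'M[C]_(k.+1, N * k.+1) := (c%:C)%C *: lin1_mx (f x).
have c2 : c ^+ 2 = (64 ^+ Q)^-1.
  by rewrite /c exprVn -exprM mulnC exprM; congr ((_ ^+ Q)^-1); ring.
have FE x (v : 'rV[C]_k.+1) :
    fsq (v *m F x) = (64 ^+ Q)^-1 * fsq (tensor_pow s (a x.1) Q (delta_mx x.2 0 *m v)).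
  rewrite /F -scalemxAr fsqR c2; congr (_ * _).
  by rewrite -[RHS]fsq_mxvec; rewrite (mul_rV_lin1 (f x)).
have [p [p1 p2 p3]] := resolvent_cutoff F.
have sumF : \sum_x fsq (F x) <= e * k.+1%:R.
  apply: (@le_trans _ _ (\sum_(x : T * 'I_N) (k.+1%:R * (4 ^+ Q)^-1))); last first.
    rewrite sumr_const card_prod card_ord -[leLHS]mulr_natl mulrCA [leRHS]mulrC.
    rewrite ler_wpM2l ?ler0n // ler_pdivrMr ?exprn_gt0 ?ltr0n //.
  apply: ler_sum => x _; rewrite fsq_row.
  apply: (@le_trans _ _ (\sum_(g < k.+1) (4 ^+ Q)^-1)); last first.
    by rewrite sumr_const card_ord mulr_natl.
  apply: ler_sum => g _; rewrite rowE FE mul_delta_mx.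
  have [d [dg d_step d_parent]] := hs g.
  have sg : supported d 0 (delta_mx x.2 g : 'M[C]_(N, k.+1)).
    move=> h dh; apply/matrixP => y y'; rewrite !mxE.
    have [gh|] := eqVneq h g; last by rewrite andbF.
    by rewrite gh dg in dh.
  have := fsq_tensor_pow_supported sK d_step d_parent (ra x.1) (leqnn _) sg.
  rewrite fsq_delta mulr1 => h.
  rewrite ler_pdivrMl ?exprn_gt0 ?ltr0n //; apply: (le_trans h).
  have <- : 64 * 4^-1 = 16 :> R by lra.
  by rewrite exprMn exprVn.
exists k, s, p; split=> //.
- move=> i j h ij; have [d [dh d_step d_parent]] := hs h.
  have d1 : d (s i h) = 1%N.
    by have := d_step h i; rewrite dh double_gt0 => /(_ Q0)[].
  by apply: (d_parent (s i h)); [rewrite sK | rewrite {1}ij sK]; rewrite d1 dh.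
- exact: le_trans p3 sumF.
move=> t z; set w := z *m p.
have fw : fsq w <= fsq z by exact: p1.
(* Splitting along the small factor costs the number N of its basis vectors. *)
have wE : w = \sum_r (delta_mx r 0 : 'cV_N) *m (row r z *m p).
  apply/matrixP => i j; rewrite summxE (bigD1 i) //= big1 ?addr0 => [|r ri].
    rewrite -row_mul -/w; move: (w) => u.
    by rewrite mxE big_ord1 !mxE !eqxx mul1r.
  rewrite -row_mul -/w; move: (w) => u.
  by rewrite mxE big_ord1 !mxE eq_sym (negbTE ri) mul0r.
have fr r (v : 'rV[C]_k.+1) :
    fsq (tensor_pow s (a t) Q ((delta_mx r 0 : 'cV_N) *m (v *m p))) <= 64 ^+ Q * fsq v.
  have : fsq (v *m p *m F (t, r)) <= fsq v.
    apply: le_trans (p2 _ v); rewrite (bigD1 (t, r)) //= lerDl.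
    by apply: sumr_ge0 => x _; exact: fsq_ge0.
  by rewrite FE ler_pdivrMl ?exprn_gt0 ?ltr0n.
have fpow : fsq (tensor_pow s (a t) Q w) <= 256 ^+ Q * fsq z.
  rewrite {1}wE linear_sum /=; apply: le_trans (fsq_sum _) _.
  apply: (@le_trans _ _ (4 ^+ Q * \sum_r (64 ^+ Q * fsq (row r z)))).
    rewrite card_ord; apply: ler_pM => //; first by apply: sumr_ge0 => r _; exact: fsq_ge0.
    by apply: ler_sum => r _; exact: fr.
  by rewrite -mulr_sumr -fsq_row mulrA -exprMn (_ : 4 * 64 = 256 :> R) //; lra.
have Q1 : (0 < 2 ^ t0.+1)%N by rewrite expn_gt0.
rewrite -(ler_pXn2r Q1) ?nnegrE ?mulr_ge0 ?fsq_ge0 //.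
apply: (le_trans (fsq_tensor_op_le_pow sK (a t) t0 w)); rewrite -/Q.
rewrite exprMn (_ : 16 ^+ (2 ^ t0.+1) = 256 ^+ Q :> R); last first.
  by rewrite expnS exprM; congr (_ ^+ _); ring.
rewrite -{2}(prednK Q1) exprS mulrA; apply: ler_pM => //; first exact: fsq_ge0.
  by rewrite exprn_ge0 ?fsq_ge0.
by rewrite lerXn2r ?nnegrE ?fsq_ge0.
Qed.
End ResolventCutoff.

(** * Uniformity in the scalar coefficients *)

Section ScalarNet.
Variable R : realType.
Local Notation C := R[i].

(** This makes the scalar combinations sum_j c_j U_j a special case of the matrix
    estimate. *)
Lemma rc_contraction_scalar N n (c : 'I_n -> C) :
  \sum_j rnorm (c j) ^+ 2 <= 1 -> rc_contraction (fun j => (c j)%:M : 'M[C]_N).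
Proof.
move=> c1; have fc p q (v : 'M[C]_(p, q)) : \sum_j fsq (c j *: v) <= fsq v.
  under eq_bigr do rewrite fsqZ; rewrite -mulr_suml ler_piMl ?fsq_ge0 //.
split=> v; first by under eq_bigr do rewrite mul_scalar_mx.
under eq_bigr do rewrite mul_scalar_mx.
set u := \sum_j _; have : 2 * fsq u <= \sum_j (fsq (v j) + fsq (c j *: u)).
  rewrite {1}/fsq {1}/u rdot_suml mulr_sumr; apply: ler_sum => j _.
  rewrite rdotZl; apply: le_trans (rdot_le _ _) _.
  by rewrite !fsqZ rnorm_conj.
by rewrite big_split /=; have := fc _ _ u; lra.
Qed.

Definition grid_point D (i : 'I_(D.+1.*2.+1)) : R := (i%:R - D.+1%:R) / D.+1%:R.

Lemma grid_point_near D (x : R) : `|x| <= 1 ->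
  exists i, (x - @grid_point D i) ^+ 2 <= (D.+1%:R ^+ 2)^-1.
Proof.
move=> x1; have D0 : 0 < D.+1%:R :> R by rewrite ltr0n.
have [xl xr] : -1 <= x /\ x <= 1 by move: x1; rewrite ler_norml => /andP[].
have y0 : 0 <= (x + 1) * D.+1%:R by rewrite mulr_ge0 ?ler0n //; lra.
have /andP[t1 t2] := truncn_itv y0; set t := Num.truncn _ in t1 t2.
have tD : (t < D.+1.*2.+1)%N.
  rewrite ltnS -(ler_nat R); apply: le_trans t1 _.
  by rewrite -muln2 natrM mulrC ler_wpM2l ?ler0n //; lra.
exists (Ordinal tD); rewrite /grid_point /=.
rewrite -exprVn -subr_ge0 subr_sqr mulr_ge0 //.
  rewrite opprB addrA (_ : _ - x = (1 + t%:R - (x + 1) * D.+1%:R) / D.+1%:R); last by field.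
  by rewrite divr_ge0 ?ler0n //; move: t2; rewrite -natr1; lra.
rewrite (_ : _ + _ = (1 + (x + 1) * D.+1%:R - t%:R) / D.+1%:R); last by field.
by rewrite divr_ge0 ?ler0n //; lra.
Qed.

Lemma rnorm_sqE (z : C) : rnorm z ^+ 2 = complex.Re z ^+ 2 + complex.Im z ^+ 2.
Proof. by rewrite -cdotzz /cdot !expr2. Qed.

Lemma rnorm_distC (V : normedZmodType C) (x y : V) : rnorm (x - y) = rnorm (y - x).
Proof. by rewrite /rnorm distrC. Qed.

(** Rounding on a grid of mesh of order 1/n; a finite net of the ball of l2 of
    dimension [n] is needed because the cutoff only serves finite families. *)
Lemma grid_near n (c : 'I_n -> C) : \sum_j rnorm (c j) ^+ 2 <= 1 ->
  let D := n.*2.+1 in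
  exists g : {ffun 'I_n -> 'I_(D.+1.*2.+1) * 'I_(D.+1.*2.+1)},
  n%:R * \sum_j rnorm (c j - (@grid_point D (g j).1 +i* @grid_point D (g j).2)%C) ^+ 2 <= 1/2.
Proof.
move=> c1 D; have cj j : rnorm (c j) ^+ 2 <= 1.
  by apply: le_trans c1; rewrite (bigD1 j) //= lerDl sumr_ge0 // => i _; exact: sqr_ge0.
have small (x y : R) : x ^+ 2 + y ^+ 2 <= 1 -> `|x| <= 1.
  move=> xy; rewrite -(@ler_pXn2r _ 2) ?nnegrE // expr1n real_normK ?num_real //.
  by have := sqr_ge0 y; lra.
have gr j : exists i : 'I_(D.+1.*2.+1) * 'I_(D.+1.*2.+1),
   rnorm (c j - (@grid_point D i.1 +i* @grid_point D i.2)%C) ^+ 2 <= 2 * (D.+1%:R ^+ 2)^-1.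
  have := cj j; rewrite rnorm_sqE => cj1.
  have [i1 h1] := @grid_point_near D _ (small _ _ cj1).
  have [i2 h2] := @grid_point_near D _ (small _ _ (etrans (congr1 (fun x => x <= 1) (addrC _ _)) cj1)).
  by exists (i1, i2); rewrite rnorm_sqE ReB ImB /= mulr_natl mulr2n lerD.
have [g gP] := choice gr.
exists [ffun j => g j].
apply: (@le_trans _ _ (n%:R * \sum_(j < n) (2 * (D.+1%:R ^+ 2)^-1))).
  by rewrite ler_wpM2l ?ler0n //; apply: ler_sum => j _; rewrite ffunE.
rewrite sumr_const card_ord -mulr_natl.
have -> : D.+1%:R = 2 * (n%:R + 1) :> R by rewrite /D -natr1 -natr1 -muln2 natrM; ring.
have n0 : 0 <= n%:R :> R by rewrite ler0n.
rewrite (_ : _ * _ = (n%:R / (n%:R + 1)) ^+ 2 / 2); last by field; lra.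
rewrite ler_wpM2r ?invr_ge0 ?ler0n // expr_le1 ?divr_ge0 ?addr_ge0 //.
by rewrite ler_pdivrMr; lra.
Qed.

Lemma tensor_op_scalar N n k (s : 'I_n -> 'I_k -> 'I_k) (c : 'I_n -> C) (z : 'M[C]_(N, k)) :
  tensor_op s (fun j => (c j)%:M) z = \sum_j c j *: colsub (s j) z.
Proof. by apply: eq_bigr => j _; rewrite mul_scalar_mx. Qed.

Lemma fsq_colsub N n k (s : 'I_n -> 'I_k -> 'I_k) j (z : 'M[C]_(N, k)) :
  involutive (s j) -> fsq (colsub (s j) z) = fsq z.
Proof.
move=> sK; rewrite !fsq_col (reindex_inj (inv_inj sK)) /=.
by apply: eq_bigr => h _; congr fsq; apply/matrixP => x y; rewrite !mxE sK.
Qed.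

(** [asymptotic_free_family] for the given [a] together with the scalar families of a
    finite net; the triangle inequality passes from the net to all coefficients. *)
Lemma free_test_matrices N n (a : 'I_n -> 'M[C]_N) (e : R) :
  rc_contraction a -> 0 < e ->
  exists k (s : 'I_n -> 'I_k.+1 -> 'I_k.+1) (p : 'M[C]_k.+1), [/\
    (forall j, involutive (s j)) /\ (forall i j h, s i h = s j h -> i = j),
    forall q (z : 'M[C]_(q, k.+1)), fsq (z *m p) <= fsq z,
    fsq (1%:M - p) <= e * k.+1%:R,
    forall z, fsq (tensor_op s a (z *m p)) <= 16 * fsq z &
    forall (c : 'I_n -> C) (z : 'M[C]_(N, k.+1)), \sum_j rnorm (c j) ^+ 2 <= 1 ->
      fsq (\sum_j c j *: colsub (s j) (z *m p)) <= 12 ^+ 2 * fsq z].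
Proof.
move=> ra e0; pose D := n.*2.+1.
pose G : finType := {ffun 'I_n -> 'I_(D.+1.*2.+1) * 'I_(D.+1.*2.+1)}.
pose b (g : G) j : C := (@grid_point D (g j).1 +i* @grid_point D (g j).2)%C.
pose b' g j : C := if \sum_j rnorm (b g j) ^+ 2 <= 4 then ((2^-1)%:C)%C * b g j else 0.
have b'1 g : \sum_j rnorm (b' g j) ^+ 2 <= 1.
  rewrite /b'; case: (boolP (\sum_j rnorm (b g j) ^+ 2 <= 4)) => h.
    rewrite (eq_bigr (fun j => 2^-1 ^+ 2 * rnorm (b g j) ^+ 2)); last first.
      by move=> j _; rewrite rnormM exprMn rnorm_real real_normK ?num_real.
    by rewrite -mulr_sumr; lra.
  by rewrite big1 // => j _; rewrite /rnorm normr0 expr0n.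
(* Grid points are halved: rounding a vector of the unit ball may leave it, but not
   the ball of radius 2. *)
pose A (t : option G) j : 'M[C]_N := if t is Some g then (b' g j)%:M else a j.
have rA t : rc_contraction (A t) by case: t => [g|//]; exact: rc_contraction_scalar.
have [k [s [p [sK sI p1 p2 p3]]]] := asymptotic_free_family rA e0.
exists k, s, p; split=> //; first exact: (p3 None).
move=> c z c1; have [g cg0] := grid_near c1.
set w := z *m p; have fw : fsq w <= fsq z by exact: p1.
have z0 := fsq_ge0 z.
pose dd := \sum_j rnorm (c j - b g j) ^+ 2; have cg : n%:R * dd <= 1 / 2 := cg0.
have dd0 : 0 <= dd by apply: sumr_ge0 => j _; exact: sqr_ge0.
have fd : fsq (\sum_j (c j - b g j) *: colsub (s j) w) <= fsq z.
  apply: le_trans (fsq_sum _) _; under eq_bigr do rewrite fsqZ fsq_colsub //.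
  rewrite -mulr_suml card_ord mulrA -/dd; apply: le_trans fw.
  by rewrite ler_piMl ?fsq_ge0 //; lra.
have b4 : \sum_j rnorm (b g j) ^+ 2 <= 4.
  apply: (@le_trans _ _ (\sum_j (2 * rnorm (c j) ^+ 2 + 2 * rnorm (c j - b g j) ^+ 2))).
    apply: ler_sum => j _; apply: sqr_le_2sqrD; first exact: rnorm_ge0.
    have := ler_rnormD (c j) (b g j - c j); rewrite addrCA subrr addr0.
    by rewrite (rnorm_distC (b g j)) addrC.
  rewrite big_split /= -!mulr_sumr -/dd.
  have [n0|n0] := eqVneq n 0%N.
    suff -> : dd = 0 by lra.
    by rewrite /dd; move: (n0) => n1; rewrite big1 // => -[j jn]; exfalso; move: jn; rewrite n0.
  have : dd <= n%:R * dd by rewrite ler_peMl // ler1n lt0n.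
  lra.
have fb : fsq (\sum_j b g j *: colsub (s j) w) <= 64 * fsq z.
  have := p3 (Some g) z; rewrite -/w /A tensor_op_scalar /b' b4.
  under eq_bigr do rewrite -scalerA; rewrite -scaler_sumr fsqR; lra.
have -> : \sum_j c j *: colsub (s j) w = \sum_j b g j *: colsub (s j) w +
   \sum_j (c j - b g j) *: colsub (s j) w.
  by rewrite -big_split /=; apply: eq_bigr => j _; rewrite -scalerDl addrCA subrr addr0.
by have := fsqD_le (\sum_j b g j *: colsub (s j) w) (\sum_j (c j - b g j) *: colsub (s j) w); lra.
Qed.
End ScalarNet.

(** * Biorthogonal functionals *)

Section Functionals.
Variable R : realType.
Local Notation C := R[i].

(** Sylvester's determinant identity for a scalar matrix perturbed by a matrix of low
    rank, by computing the determinant of one block matrix in two ways. *)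
Lemma det_scalar_add_rank n l (a c : C) (F : 'M[C]_(n, l)) (G : 'M[C]_(l, n)) :
  a != 0 -> G *m F = 1%:M ->
  \det (a%:M + c *: (F *m G)) = a ^+ n * (1 + c / a) ^+ l.
Proof.
move=> a0 GF; pose B := block_mx (a%:M : 'M_n) F (- c *: G) (1%:M : 'M_l).
have E1 : \det B = \det (a%:M + c *: (F *m G)).
  have <- : \det (B *m block_mx 1%:M 0 (c *: G) 1%:M) = \det B.
    by rewrite det_mulmx det_lblock !det1 !mulr1.
  rewrite /B mulmx_block !mulmx1 !mulmx0 !mul1mx !add0r.
  rewrite -scalerDl addNr scale0r det_ublock det1 mulr1.
  by rewrite -scalemxAr.
rewrite -{}E1.
have <- : \det (block_mx 1%:M 0 ((c / a) *: G) 1%:M *m B) = \det B.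
  by rewrite det_mulmx det_lblock !det1 !mul1r.
rewrite /B mulmx_block !mul1mx !mul0mx !addr0.
rewrite mul_mx_scalar scalerA mulrCA divff // mulr1 -scalerDl addrN scale0r.
rewrite det_ublock det_scalar; congr (_ * _).
rewrite -scalemxAl GF -[X in _ + X]scale1r -scalerDl addrC -det_scalar.
by rewrite scalemx1.
Qed.

Lemma linear_is0 (V W : lmodType C) (f : V -> W) : linear f -> f 0 = 0.
Proof. by move=> lf; have := lf (-1) 0 0; rewrite scaler0 addr0 scaleN1r addNr. Qed.

Lemma linear_isZ (V W : lmodType C) (f : V -> W) c x : linear f -> f (c *: x) = c *: f x.
Proof. by move=> lf; have := lf c x 0; rewrite (linear_is0 lf) !addr0. Qed.

Lemma linear_isB (V W : lmodType C) (f : V -> W) x y : linear f -> f (x - y) = f x - f y.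
Proof. by move=> lf; rewrite addrC -scaleN1r lf scaleN1r addrC. Qed.

Lemma linear_is_sum (V W : lmodType C) (f : V -> W) I (r : seq I) (F : I -> V) :
  linear f -> f (\sum_(i <- r) F i) = \sum_(i <- r) f (F i).
Proof.
move=> lf; apply: (big_morph f) => [x y|]; last exact: linear_is0.
by rewrite -[x]scale1r lf !scale1r.
Qed.

Section Embedded.
Variables (X : normedModType C) (H : hilbertType R) (J : X -> (H -> H)).
Hypothesis Jlin : linear J.
Hypothesis Jiso : forall x, opnorm (J x) = (rnorm x)%:E.

Definition functional_bound (f : (H -> H) -> C) (b : R) : Prop :=
  forall x, rnorm (f (J x)) <= b * rnorm x.

Lemma scalar_combination n (c : 'I_n -> C) (f : 'I_n -> (H -> H) -> C) :
  (forall i, scalar (f i)) -> scalar (fun T => \sum_i c i * f i T).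
Proof.
move=> lf a S T; rewrite mulr_sumr -big_split /=; apply: eq_bigr => i _.
by rewrite lf mulrDr mulrCA.
Qed.

Lemma rnorm_sum (V : normedZmodType C) (I : finType) (F : I -> V) :
  rnorm (\sum_i F i) <= \sum_i rnorm (F i).
Proof.
elim/big_ind2 : _ => [|x x' y y' h h'|//]; first by rewrite /rnorm normr0.
by apply: le_trans (ler_rnormD _ _) _; exact: lerD.
Qed.

Lemma functional_bound_sum n (c : 'I_n -> C) f (d : 'I_n -> R) :
  (forall i, functional_bound (f i) (d i)) ->
  functional_bound (fun T => \sum_i c i * f i T) (\sum_i rnorm (c i) * d i).
Proof.
move=> bf x; apply: le_trans (rnorm_sum _) _; rewrite mulr_suml.
apply: ler_sum => i _; rewrite rnormM -mulrA ler_wpM2l ?rnorm_ge0 //; exact: bf.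
Qed.

Lemma rnorm_eq0 (V : normedZmodType C) (x : V) : rnorm x = 0 -> x = 0.
Proof. by move=> x0; apply: normr0_eq0; rewrite rnormE x0. Qed.

Lemma rnorm0 (V : normedZmodType C) : rnorm (0 : V) = 0.
Proof. by rewrite /rnorm normr0. Qed.

Lemma rnormN (V : normedZmodType C) (x : V) : rnorm (- x) = rnorm x.
Proof. by rewrite /rnorm normrN. Qed.

Lemma rnorm_ip (u v : H) : rnorm (ip u v : C) <= rnorm u * rnorm v.
Proof.
rewrite -ler_sqr ?nnegrE ?mulr_ge0 ?rnorm_ge0 //.
have := dot_CauchySchwarz (@ip R H) u v.
rewrite -!sqr_norm_ip exprMn !rnormE -!rmorphXn /= -rmorphM /= lecR.
by [].
Qed.

Lemma rnorm_J x h : rnorm h <= 1 -> rnorm (J x h) <= rnorm x.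
Proof.
move=> h1; rewrite -lee_fin -Jiso; apply: ereal_sup_ubound; exists h => //.
Qed.

(** [J] realizes [X] as a space of operators, so a matrix coefficient of operators that
    is nonzero at [J x] will do; it is defined on the whole space of functions. *)
Lemma norming_functional x : x != 0 ->
  exists f : (H -> H) -> C, [/\ scalar f, functional_bound f (rnorm x) & f (J x) != 0].
Proof.
move=> x0; have [h [h1 Jh]] : exists h, rnorm h <= 1 /\ J x h != 0.
  apply: contrapT => nh.
  have : (opnorm (J x) <= 0)%E.
    apply: ub_ereal_sup => _ [h h1 <-]; rewrite lee_fin.
    have [->|Jh] := eqVneq (J x h) 0; first by rewrite rnorm0.
    by exfalso; apply: nh; exists h.
  rewrite Jiso lee_fin => xle; move/eqP: x0; apply; apply: rnorm_eq0.
  by apply/eqP; rewrite eq_le xle rnorm_ge0.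
exists (fun T => ip (T h) (J x h)); split.
- by move=> c S T; rewrite (linearPl (@ip R H)).
- move=> y; apply: le_trans (rnorm_ip _ _) _; rewrite mulrC.
  by apply: ler_pM; rewrite ?rnorm_ge0 ?rnorm_J.
by rewrite -sqr_norm_ip sqrf_eq0 normr_eq0.
Qed.

(** The functionals live on the ambient space of functions, so that they define maps
    on the range of [J] as well as functionals on [X]. *)
Definition admissible (f : (H -> H) -> C) := scalar f /\ exists b, functional_bound f b.

Lemma admissible_sum n (c : 'I_n -> C) f :
  (forall i, admissible (f i)) -> admissible (fun T => \sum_i c i * f i T).
Proof.
move=> af; split; first by apply: scalar_combination => i; have [] := af i.
have [d hd] := choice (fun i => (af i).2).
by exists (\sum_i rnorm (c i) * d i); exact: functional_bound_sum.
Qed.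

Lemma scalar_funB (f : (H -> H) -> C) S T : scalar f -> f (S - T) = f S - f T.
Proof. by move=> lf; rewrite addrC -scaleN1r lf mulN1r addrC. Qed.

Lemma scalar_funZ (f : (H -> H) -> C) c S : scalar f -> f (c *: S) = c * f S.
Proof.
move=> lf; have f0 : f 0 = 0 by have := scalar_funB 0 0 lf; rewrite !subrr.
by rewrite -[c *: S]addr0 lf f0 addr0.
Qed.

Lemma scalar_fun_sum I (r : seq I) (f : (H -> H) -> C) (F : I -> (H -> H)) :
  scalar f -> f (\sum_(i <- r) F i) = \sum_(i <- r) f (F i).
Proof.
move=> lf; apply: (big_morph f) => [S T|]; last first.
  by have := scalar_funB 0 0 lf; rewrite !subrr.
by rewrite -[S]scale1r lf mul1r scale1r.
Qed.

(** Induction: as the vectors found so far do not span, correct a vector outside their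
    span by its coordinates, normalize the result and make the new functional vanish on the
    old vectors. *)
Lemma biorthogonal_system : ~ finite_dim [set: X] -> forall n,
  exists (f : 'I_n -> (H -> H) -> C) (z : 'I_n -> X),
    (forall i, admissible (f i)) /\ forall i j, f i (J (z j)) = (i == j)%:R.
Proof.
move=> infX; elim=> [|n [f [z [af fz]]]].
  by exists (fun _ _ => 0), (fun _ => 0); split=> -[].
have [x xP] : exists x, x != \sum_i f i (J x) *: z i.
  apply: contrapT => nx; apply: infX; exists n, z.
  apply/seteqP; split=> x _ //=.
  exists (fun i => f i (J x)) => //; apply/eqP/negPn/negP => h.
  by apply: nx; exists x; rewrite eq_sym.
pose y := x - \sum_i f i (J x) *: z i.
have y0 : y != 0 by rewrite subr_eq0.
have Jy : J y = J x - \sum_i f i (J x) *: J (z i).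
  rewrite /y (linear_isB _ _ Jlin) (linear_is_sum _ _ Jlin); congr (_ - _).
  by apply: eq_bigr => i _; rewrite (linear_isZ _ _ Jlin).
have fy i : f i (J y) = 0.
  have lf := (af i).1; rewrite Jy (scalar_funB _ _ lf) (scalar_fun_sum _ _ lf).
  rewrite (bigD1 i) //= scalar_funZ // fz eqxx mulr1 big1 ?addr0 ?subrr // => j ji.
  by rewrite scalar_funZ // fz eq_sym (negbTE ji) mulr0.
have [g [lg bg gy]] := norming_functional y0.
pose h T := g T - \sum_i g (J (z i)) * f i T.
have ah : admissible h.
  have [l1 [b hb]] := admissible_sum (fun i => g (J (z i))) af.
  split=> [c S T|]; first by rewrite /h l1 lg; ring.
  exists (rnorm y + b) => v; rewrite mulrDl; apply: le_trans (ler_rnormD _ _) _.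
  by apply: lerD; [exact: bg | rewrite rnormN; exact: hb].
have hy : h (J y) = g (J y).
  by rewrite /h big1 ?subr0 // => i _; rewrite fy mulr0.
have hz j : h (J (z j)) = 0.
  rewrite /h (bigD1 j) //= fz eqxx mulr1 big1 ?addr0 ?subrr // => i ij.
  by rewrite fz (negbTE ij) mulr0.
exists (fun i => if unlift ord_max i is Some i' then f i' else h).
exists (fun i => if unlift ord_max i is Some i' then z i' else (g (J y))^-1 *: y).
split=> [i|i j]; first by case: unliftP.
case: (unliftP ord_max i) => [i'|] ->; case: (unliftP ord_max j) => [j'|] ->.
- by rewrite fz (inj_eq lift_inj).
- by rewrite (linear_isZ _ _ Jlin) (scalar_funZ _ _ (af i').1) fy mulr0 eq_sym (negbTE (neq_lift _ _)).
- by rewrite hz (negbTE (neq_lift _ _)).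
- by rewrite (linear_isZ _ _ Jlin) (scalar_funZ _ _ ah.1) hy mulVf // eqxx.
Qed.

End Embedded.
End Functionals.

(** * The Dvoretzky-Rogers lemma *)

Section DvoretzkyRogers.
Variable R : realType.
Local Notation C := R[i].

Lemma rnorm_prod (I : finType) (F : I -> C) : rnorm (\prod_i F i) = \prod_i rnorm (F i).
Proof.
by apply: (big_morph _ (@rnormM R)); rewrite /rnorm normr1.
Qed.

Lemma rnormX (z : C) n : rnorm (z ^+ n) = rnorm z ^+ n.
Proof.
elim: n => [|n IH]; first by rewrite !expr0 /rnorm normr1.
by rewrite !exprS rnormM IH.
Qed.

Lemma rnorm_det_le n (b : R) (M : 'M[C]_n) :
  (forall i j, rnorm (M i j) <= b) -> rnorm (\det M) <= #|{: {perm 'I_n}}|%:R * b ^+ n.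
Proof.
move=> Mb; apply: le_trans (rnorm_sum _) _.
rewrite mulr_natl -sumr_const; apply: ler_sum => s _.
rewrite rnormM rnormX (_ : rnorm (-1) = 1) ?expr1n ?mul1r; last first.
  by rewrite /rnorm normrN normr1.
rewrite rnorm_prod -[X in b ^+ X](card_ord n) -prodr_const.
by apply: ler_prod => i _; rewrite rnorm_ge0 Mb.
Qed.

Lemma fsq_entry p q (A : 'M[C]_(p, q)) i j : rnorm (A i j) ^+ 2 <= fsq A.
Proof.
rewrite fsqE (bigD1 i) //= (bigD1 j) //= -addrA lerDl addr_ge0 //.
  by apply: sumr_ge0 => ? _; exact: sqr_ge0.
by apply: sumr_ge0 => ? _; apply: sumr_ge0 => ? _; exact: sqr_ge0.
Qed.

Lemma col_fsqE p (A : 'cV[C]_p) : fsq A = \sum_i rnorm (A i 0) ^+ 2.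
Proof. by rewrite fsqE; apply: eq_bigr => i _; rewrite big_ord1. Qed.

Lemma fsq_proj n l (F : 'M[C]_(n, l)) (v : 'cV[C]_n) : adj F *m F = 1%:M ->
  fsq v = fsq (v - F *m (adj F *m v)) + fsq (adj F *m v).
Proof.
move=> FF; have E : fsq (F *m (adj F *m v)) = fsq (adj F *m v).
  by rewrite {1}/fsq rdot_mulmxl mulmxA FF mul1mx.
rewrite fsqB E [rdot v _]rdotC rdot_mulmxl -/(fsq _); ring.
Qed.

Lemma adj_mul_self n (u : 'cV[C]_n) : adj u *m u = ((fsq u)%:C%C)%:M.
Proof.
apply/matrixP => i j; rewrite !ord1 !mxE eqxx mulr1n col_fsqE rmorph_sum /=.
by apply: eq_bigr => k _; rewrite !mxE mulrC -normCK rmorphXn /= -rnormE.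
Qed.

Section Embedded.
Variables (X : normedModType C) (H : hilbertType R) (J : X -> (H -> H)).
Hypothesis Jlin : linear J.
Hypothesis Jiso : forall x, opnorm (J x) = (rnorm x)%:E.

(** The image of [x] in the quotient of [X] by the common kernel of the [f i], in
    coordinates. *)
Definition coords n (f : 'I_n -> (H -> H) -> C) x : 'cV[C]_n := \col_i f i (J x).

(** The quotient map followed by [M] is a contraction from [X] to l2. *)
Definition contractive n (f : 'I_n -> (H -> H) -> C) p (M : 'M[C]_(p, n)) : Prop :=
  forall x, fsq (M *m coords f x) <= rnorm x ^+ 2.

(** A contraction to l2 of nearly maximal determinant, that is, a nearly maximal
    ellipsoid.  The biorthogonal vectors bound the entries of the contractive matrices,
    and bounded functionals provide one with nonzero determinant. *)
Lemma near_maximal_volume n (f : 'I_n -> (H -> H) -> C) (z : 'I_n -> X) (th : R) :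
  0 < th < 1 -> (forall i, admissible J (f i)) ->
  (forall i j, f i (J (z j)) = (i == j)%:R) ->
  exists M : 'M[C]_n, contractive f M /\
    forall D : 'M[C]_n, contractive f (D *m M) -> rnorm (\det D) * th < 1.
Proof.
move=> /andP[th0 th1] af fz.
pose S := [set r : R | exists M : 'M[C]_n, contractive f M /\ r = rnorm (\det M)].
have [d hd] := choice (fun i => (af i).2).
pose b := 1 + \sum_i rnorm (z i).
have b0 : 0 <= b by rewrite addr_ge0 // sumr_ge0 // => i _; exact: rnorm_ge0.
have Sb : ubound S (#|{: {perm 'I_n}}|%:R * b ^+ n).
  move=> _ [M [cM ->]]; apply: rnorm_det_le => i j.
  have zb : rnorm (z j) <= b.
    rewrite /b (bigD1 j) //= addrCA lerDl addr_ge0 // sumr_ge0 // => ? _.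
    exact: rnorm_ge0.
  rewrite -ler_sqr ?nnegrE ?rnorm_ge0 //.
  have := fsq_entry (M *m coords f (z j)) i 0.
  have -> : M *m coords f (z j) = col j M.
    rewrite colE; congr (M *m _); apply/matrixP => x y.
    by rewrite !mxE fz (ord1 y) eqxx andbT.
  have := cM (z j); rewrite (_ : M *m coords f (z j) = col j M); last first.
    rewrite colE; congr (M *m _); apply/matrixP => x y.
    by rewrite !mxE fz (ord1 y) eqxx andbT.
  rewrite mxE => h1 h2; apply: (le_trans h2); apply: (le_trans h1).
  by rewrite ler_sqr ?nnegrE ?rnorm_ge0.
(* A contractive matrix of nonzero determinant: a small multiple of the identity. *)
pose e2 := 1 + \sum_i d i ^+ 2.
have e20 : 1 <= e2 by rewrite lerDl sumr_ge0 // => i _; exact: sqr_ge0.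
have e2i : e2^-1 <= 1 by rewrite invf_le1 //; lra.
have e2p : 0 < e2^-1 by rewrite invr_gt0; lra.
have S0 : S ((e2^-1) ^+ n).
  exists ((e2^-1)%:C%C)%:M; split; last first.
    by rewrite det_scalar rnormX rnorm_real gtr0_norm.
  move=> x; rewrite mul_scalar_mx fsqR col_fsqE.
  apply: (@le_trans _ _ ((e2^-1) ^+ 2 * \sum_i (d i ^+ 2 * rnorm x ^+ 2))).
    rewrite ler_wpM2l ?sqr_ge0 //; apply: ler_sum => i _.
    rewrite mxE -exprMn ler_sqr ?nnegrE ?rnorm_ge0 //; first exact: hd.
    by apply: le_trans (hd i x); exact: rnorm_ge0.
  have sd : 0 <= \sum_i d i ^+ 2 by apply: sumr_ge0 => i _; exact: sqr_ge0.
  rewrite -mulr_suml mulrA ler_piMl ?sqr_ge0 // expr2 -mulrA.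
  apply: mulr_ile1 => //; [exact: ltW | by apply: mulr_ge0 => //; exact: ltW |].
  by rewrite mulrC ler_pdivrMr ?mul1r /e2 ?lerDr //; lra.
have hS : has_sup S by split; [exists ((e2^-1) ^+ n) | exists (#|{: {perm 'I_n}}|%:R * b ^+ n)].
have sS : 0 < sup S.
  by apply: (@lt_le_trans _ _ ((e2^-1) ^+ n)); [rewrite exprn_gt0 | exact: (sup_upper_bound hS S0)].
have eps0 : 0 < (1 - th) * sup S by rewrite mulr_gt0 //; lra.
have [_ [M [cM ->]] Mbig] := sup_adherent eps0 hS.
have {}Mbig : th * sup S < rnorm (\det M) by lra.
exists M; split=> // D cD.
have : rnorm (\det (D *m M)) <= sup S by apply: (sup_upper_bound hS); exists (D *m M).
rewrite det_mulmx rnormM => DM.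
have [->|D0] := eqVneq (rnorm (\det D)) 0; first by rewrite mul0r.
have Dp : 0 < rnorm (\det D) by rewrite lt_neqAle eq_sym D0 rnorm_ge0.
have : rnorm (\det D) * (th * sup S) < sup S.
  by apply: lt_le_trans DM; rewrite ltr_pM2l.
by rewrite mulrA -ltr_pdivlMr // divff ?gt_eqF.
Qed.

Lemma coordsZ n (f : 'I_n -> (H -> H) -> C) c x : (forall i, admissible J (f i)) ->
  coords f (c *: x) = c *: coords f x.
Proof.
by move=> af; apply/matrixP => i j; rewrite !mxE (linear_isZ _ _ Jlin) (scalar_funZ _ _ (af i).1).
Qed.

(** Choose a contraction [M] to l2 of dimension [2m] with nearly maximal determinant
    and build orthonormal vectors one by one.  When fewer than [m] of them have been
    found, let [P] be the projection on their complement.  If P M were at most 1/2 in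
    norm, M could be stretched by 5/4 on the range of [P] and compressed by 4/5 on the
    complement, staying a contraction; since the range of [P] has the larger dimension
    this multiplies the determinant by at least 25/16, a contradiction.  So some [x] in
    the unit ball has P M x longer than 1/2, and its direction is the next vector. *)
Lemma dvoretzky_rogers : ~ finite_dim [set: X] -> forall m,
  exists (f : 'I_m -> (H -> H) -> C) (x : 'I_m -> X), [/\
    forall i, scalar (f i),
    forall v, \sum_i rnorm (f i (J v)) ^+ 2 <= rnorm v ^+ 2,
    forall i, rnorm (x i) <= 1 &
    forall i, 1 / 2 <= complex.Re (f i (J (x i)))].
Proof.
move=> infX m; pose n := m.*2.
have [g [z [ag gz]]] := biorthogonal_system Jlin Jiso infX n.
have [|M [cM Mmax]] := @near_maximal_volume n g z (16 / 25) _ ag gz; first by lra.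
have step l (F : 'M[C]_(n, l)) : (l < m)%N -> adj F *m F = 1%:M ->
    exists x, rnorm x <= 1 /\
      1 / 4 < fsq (M *m coords g x - F *m (adj F *m (M *m coords g x))).
  move=> lm FF; apply: contrapT => nx.
  have small x : fsq (M *m coords g x - F *m (adj F *m (M *m coords g x))) <=
      1 / 4 * rnorm x ^+ 2.
    have [x0|x0] := eqVneq (rnorm x) 0.
      have x00 := rnorm_eq0 x0.
      have -> : coords g x = 0.
        have := coordsZ 0 x ag; rewrite !scale0r => <-.
        by rewrite x00.
      by rewrite !mulmx0 subr0 fsq0 mulr_ge0 ?sqr_ge0.
    have xp : 0 < rnorm x by rewrite lt_neqAle eq_sym x0 rnorm_ge0.
    rewrite leNgt; apply/negP => big; apply: nx.
    exists (((rnorm x)^-1)%:C%C *: x); split.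
      by rewrite rnormZ rnorm_real gtr0_norm ?invr_gt0 // mulVf.
    rewrite (coordsZ _ _ ag) -!scalemxAr -scalerBr fsqR exprVn.
    by rewrite ltr_pdivlMl ?exprn_gt0 // mulrC.
  (* D is 5/4 on the range of the projection and 4/5 = 5/4 - 9/20 on its complement. *)
  pose D : 'M[C]_n := ((5 / 4)%:C%C)%:M + ((- (9 / 20))%:C%C) *: (F *m adj F).
  have cD : contractive g (D *m M).
    move=> x; rewrite -mulmxA; set v := M *m coords g x.
    have := small x; rewrite -/v; set u := v - _ => su.
    have -> : D *m v = ((5 / 4)%:C%C) *: u + ((4 / 5)%:C%C) *: (F *m (adj F *m v)).
      rewrite /D mulmxDl mul_scalar_mx -scalemxAl /u scalerBr !mulmxA.
      rewrite -addrA -scaleNr -scalerDl; congr (_ + _ *: _).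
      by rewrite -rmorphN -rmorphD /=; congr (_%:C)%C; lra.
    have EF : fsq (F *m (adj F *m v)) = fsq (adj F *m v).
      by rewrite {1}/fsq rdot_mulmxl mulmxA FF mul1mx.
    have uF : rdot u (F *m (adj F *m v)) = 0.
      rewrite rdotC rdot_mulmxl /u mulmxBr [adj F *m (F *m _)]mulmxA FF mul1mx subrr.
      by rewrite rdotC rdot0l.
    rewrite fsqD !fsqR EF rdotRl rdotC rdotRl rdotC uF.
    have := fsq_proj v FF; rewrite -/u.
    have := cM x; rewrite -/v.
    have := fsq_ge0 (adj F *m v).
    have := fsq_ge0 u.
    lra.
  have := Mmax D cD.
  rewrite (det_scalar_add_rank _ _ FF); last first.
    by apply/negP => /eqP /complexI; lra.
  rewrite -[1 : C]/((1 : R)%:C%C) -fmorphV -rmorphM -rmorphD rnormM !rnormX !rnorm_real.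
  rewrite !gtr0_norm; try lra.
  have -> : 1 + - (9 / 20) / (5 / 4) = 16 / 25 :> R by lra.
  rewrite /n -muln2 mulnC exprM (_ : (5 / 4) ^+ 2 = 25 / 16 :> R); last by lra.
  rewrite -mulrA -exprSr.
  have -> : (25 / 16) ^+ m = (25 / 16) ^+ (m - l.+1) * (25 / 16) ^+ l.+1 :> R.
    by rewrite -exprD subnK.
  rewrite -mulrA -exprMn (_ : 25 / 16 * (16 / 25) = 1 :> R); last by lra.
  rewrite expr1n mulr1 ltNge => /negP; apply.
  by apply: exprn_ege1; lra.
have build l : (l <= m)%N -> exists F : 'M[C]_(n, l), adj F *m F = 1%:M /\
    forall j, exists x, rnorm x <= 1 /\
      1 / 2 <= complex.Re ((adj F *m (M *m coords g x)) j 0).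
  elim: l => [|l IH] lm.
    by exists 0; split; [apply/matrixP => -[] | case].
  have [F [FF Fx]] := IH (ltnW lm).
  have [x [x1 xbig]] := step l F lm FF.
  move: xbig; set v := M *m coords g x; set u := v - _ => ubig.
  have r2 : Num.sqrt (fsq u) ^+ 2 = fsq u by rewrite sqr_sqrtr ?fsq_ge0.
  set r := Num.sqrt (fsq u) in r2.
  have r0 : 0 <= r by exact: sqrtr_ge0.
  have rp : 1 / 2 < r by rewrite -ltr_sqr ?nnegrE // r2; lra.
  pose e : 'cV[C]_n := (r^-1)%:C%C *: u.
  have Fu : adj F *m u = 0.
    by rewrite /u mulmxBr [adj F *m (F *m _)]mulmxA FF mul1mx subrr.
  have vE : v = u + F *m (adj F *m v) by rewrite /u subrK.
  have ee : adj e *m e = 1%:M.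
    rewrite adj_mul_self /e fsqR -r2 -exprMn mulVf ?expr1n //.
    by apply/negP => /eqP; lra.
  have Fe : adj F *m e = 0 by rewrite /e -scalemxAr Fu scaler0.
  have eF : adj e *m F = 0 by rewrite -[F in LHS]adjK -adjM Fe /adj map_mx0 trmx0.
  exists (row_mx e F : 'M_(n, 1 + l)).
  have adjE : adj (row_mx e F : 'M_(n, 1 + l)) = col_mx (adj e) (adj F).
    by rewrite /adj map_row_mx tr_row_mx.
  split.
    rewrite adjE [LHS](mul_col_row (adj e) (adj F) e F) ee Fe eF FF.
    exact: (esym (scalar_mx_block 1 l (1 : C))).
  (* The new vector e comes first, so that the dimension 1 + l is convertible to l.+1. *)
  have colU w j' : ((col_mx (adj e) (adj F) : 'M_(1 + l, n)) *m w) (lshift l j') 0 =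
      (adj e *m w : 'cV_1) j' 0 by rewrite mul_col_mx col_mxEu.
  have colD w j' : ((col_mx (adj e) (adj F) : 'M_(1 + l, n)) *m w) (rshift 1 j') 0 =
      (adj F *m w : 'cV_l) j' 0 by rewrite mul_col_mx col_mxEd.
  move=> j; rewrite adjE; case: (@split_ordP 1 l j) => [j' ->|j' ->]; last first.
    have [y [y1 yb]] := Fx j'; exists y; split=> //.
    by move: yb; rewrite -(colD _ j').
  exists x; split=> //.
  suff : 1 / 2 <= complex.Re ((adj e *m v) j' 0) by rewrite -(colU _ j').
  rewrite vE mulmxDr mulmxA eF mul0mx addr0.
  rewrite (ord1 j'); have uE : u = (r%:C%C) *: e.
    rewrite /e scalerA -rmorphM mulfV ?scale1r //.
    by apply/negP => /eqP; lra.
  by rewrite uE -scalemxAr ee !mxE eqxx mulr1 /=; lra.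
have [F [FF Fx]] := build m (leqnn m).
have [x xP] := choice Fx.
pose f (i : 'I_m) T := \sum_j (adj F *m M) i j * g j T.
have fE v i : f i (J v) = (adj F *m (M *m coords g v)) i 0.
  by rewrite mulmxA mxE; apply: eq_bigr => j _; congr (_ * _); rewrite mxE. 
exists f, x; split.
- by move=> i; apply: scalar_combination => j; exact: (ag j).1.
- move=> v; apply: le_trans (cM v).
  under eq_bigr do rewrite fE; rewrite -col_fsqE (fsq_proj (M *m coords g v) FF).
  by rewrite lerDr fsq_ge0.
- by move=> i; exact: (xP i).1.
- by move=> i; rewrite fE; exact: (xP i).2.
Qed.

End Embedded.
End DvoretzkyRogers.

(** * Truncation in l2 *)

Section Truncation.
Variable R : realType.
Local Notation C := R[i].
Local Notation l2 := (ell2 R).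

Lemma sqsummable_finite (f : nat -> C) N :
  (fun k => if (k < N)%N then f k else 0) \in @sqsummable_pred R.
Proof.
apply/asboolP/sqsummableP; exists (\sum_(i < N) rnorm (f i) ^+ 2) => n.
rewrite /series /=.
have sq (k : nat) : 0 <= rnorm (if (k < N)%N then f k else 0) ^+ 2 by exact: sqr_ge0.
have [nN|Nn] := leqP n N.
  rewrite -(big_mkord xpredT (fun i => rnorm (f i) ^+ 2)) (big_cat_nat (leq0n n) nN) /=.
  rewrite -[leLHS]addr0; apply: lerD; last by apply: sumr_ge0 => i _; exact: sqr_ge0.
  by rewrite !big_mkord; apply: ler_sum => i _; rewrite (leq_trans (ltn_ord i) nN).
rewrite (big_cat_nat (leq0n N) (ltnW Nn)) /= [X in _ + X]big_nat [X in _ + X]big1 ?addr0.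
  by rewrite big_mkord; apply: ler_sum => i _; rewrite ltn_ord.
by move=> i /andP[Ni _]; rewrite ltnNge Ni /= rnorm0 expr0n.
Qed.

Definition ell2_of (f : nat -> C) N : l2 := Ell2 (sqsummable_finite f N).

Lemma ell2_ofE f N k : ell2_of f N k = if (k < N)%N then f k else 0.
Proof. by []. Qed.

Lemma ell2_eq (x y : l2) : (forall k, x k = y k) -> x = y.
Proof. by move=> xy; apply/val_inj/funext. Qed.

Lemma rnorm_ell2_of f N : rnorm (ell2_of f N) ^+ 2 = \sum_(i < N) rnorm (f i) ^+ 2.
Proof.
have E n : (N <= n)%N -> series (fun k => rnorm (ell2_of f N k) ^+ 2) n =
    \sum_(i < N) rnorm (f i) ^+ 2.
  move=> Nn; rewrite /series /= (big_cat_nat (leq0n N) Nn) /= [X in _ + X]big_nat [X in _ + X]big1 ?addr0.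
    by rewrite big_mkord; apply: eq_bigr => i _; rewrite /= ltn_ord.
  by move=> i /andP[Ni _]; rewrite /= ltnNge Ni /= rnorm0 expr0n.
apply/eqP; rewrite eq_le -{2}(E N) // ell2_sum_le_rnorm andbT ell2_sqr_rnorm.
apply: limr_le; first exact: ell2P.
by exists N => // n /= Nn; rewrite E.
Qed.

Definition trunc N (x : l2) : l2 := ell2_of x N.

Lemma trunc_linear N : linear (trunc N).
Proof.
move=> c x y; apply: ell2_eq => k.
have -> : (c *: trunc N x + trunc N y) k = c * trunc N x k + trunc N y k by [].
rewrite !ell2_ofE; case: ifP => _; last by rewrite mulr0 addr0.
by [].
Qed.

Lemma truncB N x y : trunc N (x - y) = trunc N x - trunc N y.
Proof. by rewrite addrC -scaleN1r trunc_linear scaleN1r addrC. Qed.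

Lemma rnorm_trunc N x : rnorm (trunc N x) <= rnorm x.
Proof.
rewrite -ler_sqr ?nnegrE ?rnorm_ge0 // rnorm_ell2_of.
by have := ell2_sum_le_rnorm x N; rewrite /series /= big_mkord.
Qed.

Lemma trunc_near (x : l2) (e : R) : 0 < e ->
  exists N0, forall N, (N0 <= N)%N -> rnorm (x - trunc N x) <= e.
Proof.
move=> e0; set u := series (fun k => rnorm (x k) ^+ 2).
have uc : u @ \oo --> limn u by exact: ell2P.
have u_le n : u n <= limn u by exact: ell2_sum_le.
have [N0 _ hN0] : \forall n \near \oo, limn u - e ^+ 2 < u n.
  by apply: (cvgr_gt _ uc); rewrite ltrBlDr ltrDl exprn_gt0.
exists N0 => N hN; rewrite -ler_sqr ?nnegrE ?rnorm_ge0 //; last exact: ltW.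
rewrite ell2_sqr_rnorm.
apply: limr_le; first exact: ell2P.
exists N => // n /= Nn.
have -> : (fun k => rnorm ((x - trunc N x) k) ^+ 2) =
    (fun k => if (k < N)%N then 0 else rnorm (x k) ^+ 2).
  apply/funext => k; have -> : (x - trunc N x) k = x k - trunc N x k by [].
  by rewrite ell2_ofE; case: ifP => _; rewrite ?subr0 // subrr rnorm0 expr0n.
have -> : series (fun k => if (k < N)%N then 0 else rnorm (x k) ^+ 2) n = u n - u N.
  rewrite /u /series /= !(big_cat_nat (leq0n N) Nn) /= addrAC subrr add0r.
  rewrite big_nat big1 ?add0r => [|i /andP[_ ->]//].
  by rewrite big_nat [RHS]big_nat; apply: eq_bigr => i /andP[Ni _]; rewrite ltnNge Ni.
by have := hN0 N hN; have := u_le n; rewrite /=; lra.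
Qed.

Lemma fsq_row_col n (u : 'rV[C]_n) (v : 'cV[C]_n) : fsq (u *m v) <= fsq u * fsq v.
Proof.
set w := u *m v; have [->|w0] := eqVneq (fsq w) 0; first by rewrite mulr_ge0 ?fsq_ge0.
have wp : 0 < fsq w by rewrite lt_neqAle eq_sym w0 fsq_ge0.
have := rdot_CS v (adj u *m w); rewrite -rdotC rdotC -rdot_mulmxl -/w -/(fsq w).
have -> : adj u *m w = w 0 0 *: adj u.
  apply/matrixP => i j; rewrite !mxE big_ord1 (ord1 j) !mxE mulrC.
  by congr (_ * _); rewrite !mxE.
rewrite fsqZ fsq_adj (_ : rnorm (w 0 0) ^+ 2 = fsq w); last first.
  by rewrite [in RHS]fsqE !big_ord1.
by rewrite expr2 mulrCA ler_pM2l // mulrC.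
Qed.

Lemma functional_ell2_of (phi : l2 -> C) f N : scalar phi ->
  phi (ell2_of f N) = \sum_(m < N) f m * phi (ell2_of (fun k => (k == m)%:R) m.+1).
Proof.
move=> lp; elim: N => [|N IH].
  rewrite big_ord0 (_ : ell2_of f 0 = 0); last by apply: ell2_eq.
  by have := lp (-1) 0 0; rewrite scaler0 addr0 mulN1r addNr.
rewrite big_ord_recr /= -IH addrC -lp; congr phi; apply: ell2_eq => k.
set d := ell2_of (fun _ => _%:R) N.+1.
rewrite [RHS](_ : _ = f N * d k + ell2_of f N k) // /d !ell2_ofE !ltnS; case: (ltngtP k N) => [_|_|->] /=.
- by rewrite mulr0 add0r.
- by rewrite mulr0 addr0.
by rewrite mulr1 addr0.
Qed.

(** The values of a bounded functional on the unit vectors are square summable, as one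
    sees by testing it on their own truncations; its norm on the vectors vanishing below
    [M] is then the tail of this series. *)
Lemma functional_tail (phi : l2 -> C) (c e : R) : scalar phi ->
  (forall x, rnorm (phi x) <= c * rnorm x) -> 0 < e ->
  exists M0, forall M, (M0 <= M)%N -> forall x,
    rnorm (phi (x - trunc M x)) <= e * rnorm x.
Proof.
move=> lp pc e0; pose d m := phi (ell2_of (fun k => (k == m)%:R) m.+1).
have phiB x y : phi (x - y) = phi x - phi y.
  by rewrite addrC -scaleN1r lp mulN1r addrC.
pose S := series (fun m => rnorm (d m) ^+ 2).
have SE M : S M = \sum_(m < M) rnorm (d m) ^+ 2 by rewrite /S /series /= big_mkord.
have Sc M : S M <= c ^+ 2.
  have S0 : 0 <= S M by rewrite SE; apply: sumr_ge0 => i _; exact: sqr_ge0.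
  have [->|SM0] := eqVneq (S M) 0; first exact: sqr_ge0.
  have Sp : 0 < S M by rewrite lt_neqAle eq_sym SM0.
  (* The vector on which the functional attains its norm on the first M coordinates. *)
  pose x := ell2_of (fun m => (d m)^*) M.
  have x2 : rnorm x ^+ 2 = S M.
    by rewrite rnorm_ell2_of SE; apply: eq_bigr => m _; rewrite rnorm_conj.
  have phix : phi x = ((S M)%:C)%C.
    rewrite functional_ell2_of // SE rmorph_sum /=; apply: eq_bigr => m _.
    by rewrite mulrC -normCK rmorphXn /= -rnormE.
  have := pc x; rewrite phix rnorm_real ger0_norm // -ler_sqr ?nnegrE //; last first.
    by apply: le_trans (pc x); exact: rnorm_ge0.
  by rewrite exprMn x2 expr2 ler_pM2r.
have Scvg : cvgn S.
  by apply/nneg_series_cvgP; [move=> k; exact: sqr_ge0 | exists (c ^+ 2)].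
have Sle n : S n <= limn S.
  apply: nondecreasing_cvgn_le => //; apply/nondecreasing_seqP => m.
  by rewrite /S seriesSr lerDl sqr_ge0.
have [M0 _ hM0] : \forall n \near \oo, limn S - e ^+ 2 < S n.
  by apply: (cvgr_gt _ Scvg); rewrite ltrBlDr ltrDl exprn_gt0.
exists M0 => M hM x; apply/ler_addgt0Pr => eps eps0.
have c10 : 0 < `|c| + 1 by rewrite ltr_pwDr.
have [N1 hN1] := trunc_near x (divr_gt0 eps0 c10).
pose N := maxn M N1.
have MN : (M <= N)%N by rewrite leq_maxl.
have -> : x - trunc M x = (trunc N x - trunc M x) + (x - trunc N x).
  by rewrite [RHS]addrC addrA subrK.
have phiD u v : phi (u + v) = phi u + phi v by rewrite -[u]scale1r lp mul1r scale1r.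
rewrite phiD; apply: le_trans (ler_rnormD _ _) _; apply: lerD; last first.
  apply: (le_trans (pc _)).
  apply: (@le_trans _ _ ((`|c| + 1) * (eps / (`|c| + 1)))); last first.
    by rewrite mulrC divfK // gt_eqF.
  apply: (@le_trans _ _ ((`|c| + 1) * rnorm (x - trunc N x))).
    by rewrite ler_wpM2r ?rnorm_ge0 // (le_trans (ler_norm c)) // lerDl.
  by rewrite ler_pM2l // hN1 // leq_maxr.
have -> : trunc N x - trunc M x = ell2_of (fun m => if (M <= m)%N then x m else 0) N.
  apply: ell2_eq => k; rewrite [LHS](_ : _ = trunc N x k - trunc M x k) // !ell2_ofE.
  case: (leqP M k) => Mk; first by rewrite subr0.
  by rewrite (leq_trans Mk MN) subrr.
rewrite functional_ell2_of // -ler_sqr ?nnegrE ?rnorm_ge0 ?(mulr_ge0 (ltW e0)) ?rnorm_ge0 //.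
pose u : 'rV[C]_N := \row_m (if (M <= m)%N then x m else 0).
pose v : 'cV[C]_N := \col_m (if (M <= m)%N then d m else 0).
have uv : u *m v = (\sum_(m < N) (if (M <= m)%N then x m else 0) * d m)%:M.
  apply/matrixP => i j; rewrite !ord1 !mxE eqxx mulr1n; apply: eq_bigr => m _.
  by rewrite !mxE; case: ifP; rewrite ?mul0r.
have := fsq_row_col u v; rewrite uv [X in X <= _ -> _]fsqE !big_ord1 mxE eqxx mulr1n.
move=> /le_trans; apply; rewrite exprMn mulrC; apply: ler_pM; rewrite ?fsq_ge0 //.
  rewrite fsqE; under eq_bigr => i _ do rewrite big_ord1 mxE.
  have := Sle N; have := hM0 M hM.
  rewrite /= /S /series /= (big_cat_nat (leq0n M) MN) /=.
  set A := \sum_(0 <= i < M) _; have -> : \sum_(i < N)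
     rnorm (if (M <= i)%N then d i else 0) ^+ 2 = \sum_(M <= i < N) rnorm (d i) ^+ 2.
    rewrite -(big_mkord xpredT (fun i => rnorm (if (M <= i)%N then d i else 0) ^+ 2)).
    rewrite (big_cat_nat (leq0n M) MN) /= big_nat big1 ?add0r => [|i /andP[_ iM]].
      by rewrite big_nat [RHS]big_nat; apply: eq_bigr => i /andP[-> _].
    by rewrite leqNgt iM rnorm0 expr0n.
  lra.
apply: le_trans (ell2_sum_le_rnorm x N); rewrite /series /= big_mkord fsqE big_ord1.
by apply: ler_sum => i _; rewrite mxE; case: ifP => // _; rewrite rnorm0 expr0n sqr_ge0.
Qed.

End Truncation.

(** * Compact operators are limits of their corners *)

Section Compact.
Variable R : realType.
Local Notation C := R[i].
Local Notation l2 := (ell2 R).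

(** The truncations are contractions that converge pointwise to the identity, hence
    uniformly on compact sets. *)
Lemma compact_trunc_near (K : set l2) (e : R) : compact K -> 0 < e ->
  exists N0, forall N, (N0 <= N)%N -> forall y, K y -> rnorm (y - trunc N y) <= e.
Proof.
move=> cK e0; have e30 : 0 < e / 3 by rewrite divr_gt0.
have [N hN] := choice (fun x : l2 => trunc_near x e30).
move: cK; rewrite compact_cover => cK.
have e3c : 0 < ((e / 3)%:C)%C :> C by rewrite ltcR.
have [z _|y Ky|D _ KD] := cK l2 K (fun z => (ball z (((e / 3)%:C)%C : C))°).
- exact: open_interior.
- by exists y => //; apply: nbhs_singleton; apply: nbhs_interior; apply: nbhsx_ballx.
exists (\max_(z <- D) N z)%N => M hM y Ky.
have [z zD /interior_subset yz] := KD y Ky.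
have {}yz : rnorm (z - y) < e / 3.
  by move: yz; rewrite -ball_normE /= rnormE ltcR.
have zM : (N z <= M)%N by apply: leq_trans hM; exact: leq_bigmax_seq.
have -> : y - trunc M y = (y - z) + ((z - trunc M z) + trunc M (z - y)).
  by rewrite truncB !subrKA.
apply: le_trans (ler_rnormD _ _) _.
have := ler_rnormD (z - trunc M z) (trunc M (z - y)).
have := hN z M zM; have := rnorm_trunc M (z - y); rewrite (rnorm_distC y); lra.
Qed.

(** Truncation on the left is uniform on the image of the ball by compactness.  Once
    the range is cut down to finitely many coordinates, each coordinate of [a x] is a
    bounded functional and [functional_tail] allows the truncation on the right. *)
Lemma compact_op_trunc_near (a : l2 -> l2) (c e : R) : linear a ->
  (forall x, rnorm (a x) <= c * rnorm x) ->
  compact (closure (a @` [set x : l2 | rnorm x <= 1])) -> 0 < e ->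
  exists N0, forall N, (N0 <= N)%N -> forall x,
    rnorm (a x - trunc N (a (trunc N x))) <= e * rnorm x.
Proof.
move=> la ac cK e0; have e40 : 0 < e / 4 by rewrite divr_gt0.
have [N1 hN1] := compact_trunc_near cK e40.
have left N x : (N1 <= N)%N -> rnorm (a x - trunc N (a x)) <= e / 4 * rnorm x.
  move=> NN; have [x0|x0] := eqVneq (rnorm x) 0.
    by rewrite (rnorm_eq0 x0) (linear_is0 la) (linear_is0 (@trunc_linear R N)) subrr !rnorm0 mulr0.
  have xp : 0 < rnorm x by rewrite lt_neqAle eq_sym x0 rnorm_ge0.
  have := hN1 N NN (a ((((rnorm x)^-1)%:C)%C *: x)).
  rewrite (linear_isZ _ _ la) (linear_isZ _ _ (@trunc_linear R N)) -scalerBr rnormZ rnorm_real.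
  rewrite gtr0_norm ?invr_gt0 // mulrC ler_pdivrMr //; apply.
  apply: subset_closure; exists ((((rnorm x)^-1)%:C)%C *: x); last by rewrite (linear_isZ _ _ la).
  by rewrite /= rnormZ rnorm_real gtr0_norm ?invr_gt0 // mulVf.
have eN : 0 < e / 4 / N1.+1%:R by rewrite divr_gt0 // ltr0n.
have coord r : exists M0, forall M, (M0 <= M)%N -> forall x,
    rnorm (a (x - trunc M x) r) <= e / 4 / N1.+1%:R * rnorm x.
  apply: (@functional_tail R (fun x => a x r) c) => //.
    by move=> k x y; rewrite la.
  by move=> x; apply: le_trans (ac x); exact: ell2_coord_le.
have [M hM] := choice coord.
exists (maxn N1 (\max_(r < N1) M r))%N => N; rewrite geq_max => /andP[NN /bigmax_leqP MN] x.
set y := x - trunc N x.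
have right : rnorm (trunc N1 (a y)) <= e / 4 * rnorm x.
  rewrite -ler_sqr ?nnegrE ?rnorm_ge0 ?(mulr_ge0 (ltW e40)) ?rnorm_ge0 //.
  rewrite rnorm_ell2_of.
  apply: (@le_trans _ _ (\sum_(r < N1) (e / 4 / N1.+1%:R * rnorm x) ^+ 2)).
    apply: ler_sum => r _; rewrite ler_sqr ?nnegrE ?rnorm_ge0 ?(mulr_ge0 (ltW eN)) ?rnorm_ge0 //.
    by apply: hM; exact: MN.
  rewrite sumr_const card_ord -[leLHS]mulr_natl.
  rewrite (_ : _ * _ = (N1%:R / N1.+1%:R ^+ 2) * (e / 4 * rnorm x) ^+ 2); last by field; rewrite nat1r pnatr_eq0.
  rewrite ler_piMl ?sqr_ge0 // ler_pdivrMr ?exprn_gt0 ?ltr0n // mul1r -natrX ler_nat.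
  by rewrite expnS expn1; lia.
have y2 : rnorm y <= 2 * rnorm x.
  have := ler_rnormD x (- trunc N x); rewrite rnormN -/y; have := rnorm_trunc N x; lra.
have -> : a x - trunc N (a (trunc N x)) = (a x - trunc N (a x)) + trunc N (a y).
  by rewrite /y (linear_isB _ _ la) truncB addrA subrK.
apply: le_trans (ler_rnormD _ _) _.
have := left N x NN; have := rnorm_trunc N (a y).
have : rnorm (a y) <= rnorm (a y - trunc N1 (a y)) + rnorm (trunc N1 (a y)).
  by apply: le_trans (ler_rnormD _ _); rewrite subrK.
have := left N1 y (leqnn _).
have : e / 4 * rnorm y <= e / 4 * (2 * rnorm x) by rewrite ler_pM2l.
lra.
Qed.
End Compact.

(** * Matrices of operators and completely bounded maps *)

Section Operators.
Variable R : realType.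
Local Notation C := R[i].

(** Boundedness is the form of continuity used everywhere below. *)
Lemma bounded_opsP (H : hilbertType R) (T : H -> H) :
  bounded_ops (H := H) T <->
  linear T /\ exists2 b : R, 0 < b & forall x, rnorm (T x) <= b * rnorm x.
Proof.
split=> [[lT cT]|[lT [b b0 Tb]]]; split=> //.
  pose g : {linear H -> H} := HB.pack_for {linear H -> H} T (GRing.isLinear.Build C H H _ T lT).
  have : bounded_near g (nbhs 0) by apply: continuous_linear_bounded; exact: cT.
  move=> /linear_boundedP/pinfty_ex_gt0[r r0 Tr].
  have rE : r = ((complex.Re r)%:C)%C by rewrite RRe_real // gtr0_real.
  exists (complex.Re r); first by rewrite -ltcR -rE.
  by move=> x; have := Tr x; rewrite /= rE !rnormE -rmorphM lecR.
pose g : {linear H -> H} := HB.pack_for {linear H -> H} T (GRing.isLinear.Build C H H _ T lT).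
have : continuous g; last by [].
apply: bounded_linear_continuous; apply/linear_boundedP.
exists ((b%:C)%C); split; first by apply: gtr0_real; rewrite ltcR.
move=> r br x; apply: (@le_trans _ _ ((b%:C)%C * `|x|)).
  by rewrite /= !rnormE -rmorphM lecR.
by rewrite ler_wpM2r // ltW.
Qed.

Lemma bounded_ops_subspace (H : hilbertType R) : is_subspace (bounded_ops (H := H)).
Proof.
split=> [|c S T /bounded_opsP[lS [s s0 Ss]] /bounded_opsP[lT [t t0 Tt]]]; apply/bounded_opsP.
  split; first by move=> c x y; rewrite scaler0 addr0.
  by exists 1 => // x; rewrite (rnorm0 H) mul1r rnorm_ge0.
have E x : (c *: S + T) x = c *: S x + T x by [].
split; first by move=> d x y; rewrite !E lS lT !scalerDr !scalerA (mulrC d) addrACA.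
exists (rnorm c * s + t); first by rewrite ltr_wpDl // mulr_ge0 ?rnorm_ge0 // ltW.
move=> x; rewrite E mulrDl; apply: le_trans (ler_rnormD _ _) _; apply: lerD => //.
by rewrite rnormZ -mulrA ler_wpM2l ?rnorm_ge0.
Qed.

Lemma bounded_ops_operator_space (H : hilbertType R) :
  operator_space (bounded_ops (H := H)).
Proof. by split => //; exact: bounded_ops_subspace. Qed.

Lemma subspaceZ (V : lmodType C) (E : set V) c x : is_subspace E -> E x -> E (c *: x).
Proof. by move=> [E0 EP] Ex; rewrite -[c *: x]addr0; exact: EP. Qed.

Lemma subspace_sum (V : lmodType C) (E : set V) n (c : 'I_n -> C) (x : 'I_n -> V) :
  is_subspace E -> (forall i, E (x i)) -> E (\sum_i c i *: x i).
Proof.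
move=> sE Ex; elim/big_ind : _ => [|y z Ey Ez|i _]; first exact: sE.1.
  by rewrite -[y]scale1r; exact: sE.2.
exact: subspaceZ.
Qed.

Section Maps.
Variables (V W : lmodType C) (E : set V) (F : set W) (u : V -> W).
Hypotheses (sE : is_subspace E) (lu : linear_map E F u).

Lemma linear_map0 : u 0 = 0.
Proof.
have := lu.2 (-1) 0 0 sE.1 sE.1.
by rewrite scaler0 addr0 scaleN1r addNr.
Qed.

Lemma linear_mapZ c x : E x -> u (c *: x) = c *: u x.
Proof. by move=> Ex; rewrite -[c *: x]addr0 lu.2 // ?linear_map0 ?addr0 //; exact: sE.1. Qed.

Lemma linear_map_sum n (c : 'I_n -> C) (x : 'I_n -> V) :
  (forall i, E (x i)) -> u (\sum_i c i *: x i) = \sum_i c i *: u (x i).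
Proof.
move=> Ex; elim: n c x Ex => [|n IH] c x Ex; first by rewrite !big_ord0 linear_map0.
rewrite !big_ord_recl lu.2 // ?IH //; exact: subspace_sum.
Qed.
End Maps.

(** The square of [col_norm]. *)
Definition colsq (H : hilbertType R) n (xi : 'cV[H]_n) : R := \sum_i rnorm (xi i 0) ^+ 2.

Lemma colsq_ge0 (H : hilbertType R) n (xi : 'cV[H]_n) : 0 <= colsq xi.
Proof. by apply: sumr_ge0 => i _; exact: sqr_ge0. Qed.

Lemma col_norm_le (H : hilbertType R) n (xi : 'cV[H]_n) (c : R) : 0 <= c ->
  (col_norm xi <= c) = (colsq xi <= c ^+ 2).
Proof.
move=> c0; rewrite /col_norm -/(colsq xi).
rewrite -[LHS](@ler_pXn2r _ 2) ?nnegrE ?sqrtr_ge0 // sqr_sqrtr //; exact: colsq_ge0.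
Qed.

Lemma colsqZ (H : hilbertType R) n (xi : 'cV[H]_n) (c : C) :
  colsq (map_mx (fun v => c *: v) xi) = rnorm c ^+ 2 * colsq xi.
Proof.
by rewrite /colsq mulr_sumr; apply: eq_bigr => i _; rewrite mxE rnormZ exprMn.
Qed.

Lemma mx_apply_scale (H : hilbertType R) n (T : 'M[H -> H]_n) (xi : 'cV[H]_n) (c : C) :
  mx_apply (map_mx (fun S => c *: S) T) xi = map_mx (fun v => c *: v) (mx_apply T xi).
Proof.
apply/matrixP => i j; rewrite !mxE scaler_sumr; apply: eq_bigr => k _.
by rewrite !mxE.
Qed.

Lemma mx_apply_scaler (H : hilbertType R) n (T : 'M[H -> H]_n) (xi : 'cV[H]_n) (c : C) :
  (forall i j, linear (T i j)) ->
  mx_apply T (map_mx (fun v => c *: v) xi) = map_mx (fun v => c *: v) (mx_apply T xi).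
Proof.
move=> lT; apply/matrixP => i j; rewrite !mxE scaler_sumr; apply: eq_bigr => k _.
by rewrite !mxE (linear_isZ _ _ (lT i k)).
Qed.

(** The cb norm inequality at any scale, in terms of squares, so that no matrix has to
    be normalized by hand. *)
Lemma cb_norm_apply (H K : hilbertType R) (E : set (H -> H)) (F : set (K -> K)) u
    (b kappa : R) n (T : 'M[H -> H]_n) (xi : 'cV[K]_n) :
  is_subspace E -> linear_map E F u -> F `<=` bounded_ops (H := K) ->
  (cb_norm E u <= b%:E)%E -> 0 <= b -> 0 < kappa -> (forall i j, E (T i j)) ->
  (forall zeta, colsq (mx_apply T zeta) <= kappa ^+ 2 * colsq zeta) ->
  colsq (mx_apply (map_mx u T) xi) <= (kappa * b) ^+ 2 * colsq xi.
Proof.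
move=> sE lu Fb cbu b0 k0 ET Tk.
have lin i j : linear (map_mx u T i j) by rewrite mxE; have [] := Fb _ (lu.1 _ (ET i j)).
pose T' := map_mx (fun S => ((kappa^-1)%:C)%C *: S) T.
have E1 i j : E (T' i j) by rewrite mxE; exact: subspaceZ.
have T'1 : (mx_opnorm T' <= 1)%E.
  apply: ge_ereal_sup => _ [zeta z1 <-]; rewrite lee_fin col_norm_le //.
  move: z1 => /=; rewrite col_norm_le // expr1n => z1.
  rewrite mx_apply_scale colsqZ rnorm_real gtr0_norm ?invr_gt0 //.
  rewrite exprVn ler_pdivrMl ?exprn_gt0 // mulr1.
  by apply: le_trans (Tk zeta) _; rewrite ler_piMr ?sqr_ge0.
have uT' : map_mx u T' = map_mx (fun S => ((kappa^-1)%:C)%C *: S) (map_mx u T).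
  by apply/matrixP => i j; rewrite !mxE (linear_mapZ sE lu).
have unit_bound zeta : colsq zeta <= 1 -> colsq (mx_apply (map_mx u T) zeta) <= (kappa * b) ^+ 2.
  move=> z1; have : ((col_norm (mx_apply (map_mx u T') zeta))%:E <= b%:E)%E.
    apply: le_trans cbu; apply: le_trans (ereal_sup_ubound _); last first.
      by exists n, T'; split.
    by apply: ereal_sup_ubound; exists zeta => //=; rewrite col_norm_le ?expr1n.
  rewrite lee_fin col_norm_le // uT' mx_apply_scale colsqZ rnorm_real gtr0_norm ?invr_gt0 //.
  by rewrite exprVn ler_pdivrMl ?exprn_gt0 // exprMn.
have [x0|x0] := eqVneq (colsq xi) 0.
  have -> : xi = map_mx (fun v => 0 *: v) xi.
    apply/matrixP => i j; rewrite (ord1 j) mxE scale0r; apply: rnorm_eq0.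
    move/eqP: x0; rewrite psumr_eq0 => [/allP /(_ i (mem_index_enum _)) /=|? _].
      by rewrite sqrf_eq0 => /eqP.
    exact: sqr_ge0.
  by rewrite mx_apply_scaler // !colsqZ !rnorm0 expr0n !mul0r mulr0.
have xp : 0 < colsq xi by rewrite lt_neqAle eq_sym x0 colsq_ge0.
pose r := Num.sqrt (colsq xi); have rp : 0 < r by rewrite sqrtr_gt0.
have r2 : r ^+ 2 = colsq xi by rewrite sqr_sqrtr ?ltW.
have := unit_bound (map_mx (fun v => ((r^-1)%:C)%C *: v) xi).
rewrite mx_apply_scaler // !colsqZ rnorm_real gtr0_norm ?invr_gt0 // -r2.
rewrite -exprMn mulVf ?gt_eqF // expr1n => /(_ (lexx _)).
by rewrite exprVn ler_pdivrMl ?exprn_gt0 // mulrC.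
Qed.

End Operators.

(** * Factorizations given by exactness *)

Section Exactness.
Variable R : realType.
Local Notation C := R[i].

Lemma cb_norm_ge0 (H K : hilbertType R) (E : set (H -> H)) (u : (H -> H) -> (K -> K)) :
  (0 <= cb_norm E u)%E.
Proof.
pose T : 'M[H -> H]_0 := const_mx 0.
have cn0 (L : hilbertType R) (xi : 'cV[L]_0) : col_norm xi = 0.
  by rewrite /col_norm big_ord0 sqrtr0.
apply: (@le_trans _ _ (mx_opnorm (map_mx u T))); last first.
  apply: ereal_sup_ubound; exists 0%N, T; split=> //; first by case.
  by apply: ge_ereal_sup => _ [xi _ <-]; rewrite cn0 lee_fin.
by apply: ereal_sup_ubound; exists (const_mx 0) => /=; rewrite cn0.
Qed.

(** Used to discard the value 0 in the product of two cb norms. *)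
Lemma cb_norm_eq0 (H K : hilbertType R) (E : set (H -> H)) (F : set (K -> K)) u S :
  is_subspace E -> linear_map E F u -> E `<=` bounded_ops (H := H) ->
  F `<=` bounded_ops (H := K) -> (cb_norm E u <= 0)%E -> E S -> u S = 0.
Proof.
move=> sE lu Eb Fb cu ES.
have [lS [s s0 Ss]] := (bounded_opsP S).1 (Eb _ ES).
apply/funext => x; apply: rnorm_eq0.
have := @cb_norm_apply R H K E F u 0 s 1 (const_mx S) (const_mx x) sE lu Fb cu (lexx _) s0.
rewrite mulr0 expr0n mul0r => h.
have : colsq (mx_apply (map_mx u (const_mx S : 'M_1)) (const_mx x)) <= 0.
  apply: h => [i j|zeta]; first by rewrite mxE.
  rewrite /colsq !big_ord1 mxE big_ord1 mxE -exprMn ler_sqr ?nnegrE ?rnorm_ge0 //.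
  by rewrite mulr_ge0 ?rnorm_ge0 // ltW.
rewrite /colsq big_ord1 !mxE big_ord1 !mxE => h0; apply/eqP.
by rewrite -sqrf_eq0 eq_le h0 sqr_ge0.
Qed.

(** One constant serves all finite dimensional subspaces.  A nonzero element of the
    subspace excludes that a factor of the product of cb norms vanishes, hence both
    factors are finite. *)
Lemma exact_subspace_factorization (H : hilbertType R) (Y : set (H -> H)) :
  Y `<=` bounded_ops (H := H) -> exact_space Y ->
  exists2 lam : R, 0 < lam & forall E S, is_subspace E -> finite_dim E -> E `<=` Y ->
    E S -> S != 0 ->
    exists (F : set (ell2 R -> ell2 R)) (u : (H -> H) -> (ell2 R -> ell2 R))
      (t : (ell2 R -> ell2 R) -> (H -> H)) (bu bt : R),
      [/\ is_subspace F /\ F `<=` compact_ops (H := ell2 R),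
          linear_map E F u /\ linear_map F E t,
          forall x, E x -> t (u x) = x,
          0 < bu /\ 0 < bt &
          [/\ (cb_norm E u <= bu%:E)%E, (cb_norm F t <= bt%:E)%E & bu * bt <= lam]].
Proof.
move=> Yb exY.
have [r r0 dr] : exists2 r : R, 0 <= r & (d_SK Y < r%:E)%E.
  move: exY; rewrite /exact_space; case: (d_SK Y) => [r| |] // rY.
    by exists (`|r| + 1); rewrite ?addr_ge0 // lte_fin (le_lt_trans (ler_norm r)) // ltrDl.
  by exists 0 => //; rewrite ltNye.
exists (r + 1); first by rewrite ltr_wpDl.
move=> E S sE fE EY ES S0.
have : (d_SK_fin E < r%:E)%E.
  by apply: le_lt_trans dr; apply: ereal_sup_ubound; exists E.
move=> /ereal_inf_lt[_ [F [[oF1 sF oF2] Fc] <-]] /ereal_inf_lt[_ [u [t [lu lt tu ut ->]]] prod].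
have Fb : F `<=` bounded_ops (H := ell2 R) by move=> T /Fc[].
have Eb : E `<=` bounded_ops (H := H) by move=> T /EY/Yb.
exists F, u, t.
have u0 : ~ (cb_norm E u <= 0)%E.
  move=> cu; move/eqP: S0; apply; rewrite -(tu S ES) (cb_norm_eq0 sE lu Eb Fb cu ES).
  exact: linear_map0 sF lt.
have t0 : ~ (cb_norm F t <= 0)%E.
  move=> ct; move/eqP: S0; apply; rewrite -(tu S ES).
  by apply: (cb_norm_eq0 sF lt Fb Eb ct); exact: lu.1.
move: prod; have := cb_norm_ge0 E u; have := cb_norm_ge0 F t; move: u0 t0.
case: (cb_norm E u) => [a| |//]; case: (cb_norm F t) => [b| |//].
- rewrite !lee_fin -EFinM lte_fin => a0 b0 b1 a1 ab.
  have ap : 0 < a by rewrite ltNge; apply/negP.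
  have bp : 0 < b by rewrite ltNge; apply/negP.
  exists a, b; do !split => //; rewrite ?lee_fin //; lra.
- rewrite lee_fin => a0 _ _ a1.
  by rewrite gt0_muley // lte_fin ltNge; apply/negP.
- rewrite lee_fin => _ b0 b1 _.
  by rewrite gt0_mulye // lte_fin ltNge; apply/negP.
- by rewrite mulyy.
Qed.

End Exactness.

(** * Tensors of operators on l2 with matrices *)

Section Corners.
Variable R : realType.
Local Notation C := R[i].
Local Notation l2 := (ell2 R).

Lemma ell2_sumE n (c : 'I_n -> C) (x : 'I_n -> l2) k :
  (\sum_i c i *: x i) k = \sum_i c i * x i k.
Proof. by apply: (big_morph (fun y : l2 => y k)). Qed.

Lemma rnorm_ell2_family_le n (x : 'I_n -> l2) (b : R) :
  (forall N, \sum_g \sum_(r < N) rnorm (x g r) ^+ 2 <= b) ->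
  \sum_g rnorm (x g) ^+ 2 <= b.
Proof.
move=> xb; have cv : (fun N => \sum_g series (fun k => rnorm (x g k) ^+ 2) N) @ \oo -->
    \sum_g rnorm (x g) ^+ 2.
  apply: (@cvg_big R^o _ +%R 0 xpredT _ nat \oo _ _ (fun g => rnorm (x g) ^+ 2)) => [|g _].
    exact: add_continuous.
  by rewrite ell2_sqr_rnorm; exact: ell2P.
apply: (cvgr_to_le cv); apply: nearW => N; apply: le_trans (xb N).
by apply: ler_sum => g _; rewrite /series /= big_mkord.
Qed.

Lemma sqr_sum_le n (x : 'I_n -> R) : (\sum_i x i) ^+ 2 <= n%:R * \sum_i x i ^+ 2.
Proof.
have := fsq_sum (fun i => ((x i)%:C%C)%:M : 'M[C]_1); rewrite card_ord.
have fx (y : R) : fsq (((y)%:C%C)%:M : 'M[C]_1) = y ^+ 2.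
  by rewrite fsqE !big_ord1 mxE eqxx mulr1n rnorm_real real_normK ?num_real.
under [X in _ <= _ * X -> _]eq_bigr do rewrite fx.
rewrite (_ : \sum_i _ = ((\sum_i x i)%:C%C)%:M) ?fx //.
by rewrite rmorph_sum /= [RHS]raddf_sum.
Qed.

Lemma rnorm_sum_sqr_le (V : normedModType C) n (v : 'I_n -> V) :
  rnorm (\sum_i v i) ^+ 2 <= n%:R * \sum_i rnorm (v i) ^+ 2.
Proof.
apply: le_trans (sqr_sum_le _); rewrite ler_sqr ?nnegrE ?rnorm_ge0 ?rnorm_sum //.
by apply: sumr_ge0 => i _; exact: rnorm_ge0.
Qed.

(** Coordinates are conjugated because the operator under study involves the conjugates
    of the matrices [q]. *)
Definition coord_mx N k (xi : 'I_k -> l2) : 'M[C]_(N, k) := \matrix_(r, h) (xi h r)^*.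

(** The action of 1 (x) q^* on column vectors. *)
Definition twist k (q : 'M[C]_k) (xi : 'I_k -> l2) (g : 'I_k) : l2 :=
  \sum_h (q h g)^* *: xi h.

Lemma coord_mx_twist N k (q : 'M[C]_k) (xi : 'I_k -> l2) :
  coord_mx N (twist q xi) = coord_mx N xi *m q.
Proof.
apply/matrixP => r g; rewrite !mxE ell2_sumE rmorph_sum /=; apply: eq_bigr => h _.
by rewrite !mxE rmorphM /= conjCK mulrC.
Qed.

Lemma fsq_coord_mx N k (xi : 'I_k -> l2) :
  fsq (coord_mx N xi) = \sum_h \sum_(r < N) rnorm (xi h r) ^+ 2.
Proof.
rewrite fsqE exchange_big /=; apply: eq_bigr => h _; apply: eq_bigr => r _.
by rewrite mxE rnorm_conj.
Qed.

Lemma fsq_coord_mx_le N k (xi : 'I_k -> l2) :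
  fsq (coord_mx N xi) <= \sum_h rnorm (xi h) ^+ 2.
Proof.
rewrite fsq_coord_mx; apply: ler_sum => h _.
by have := ell2_sum_le_rnorm (xi h) N; rewrite /series /= big_mkord.
Qed.

(** A contractive matrix remains contractive after tensoring with l2; it suffices to
    check finitely many coordinates. *)
Lemma twist_contraction k (q : 'M[C]_k) (xi : 'I_k -> l2) :
  (forall N (z : 'M[C]_(N, k)), fsq (z *m q) <= fsq z) ->
  \sum_g rnorm (twist q xi g) ^+ 2 <= \sum_h rnorm (xi h) ^+ 2.
Proof.
move=> q1; apply: rnorm_ell2_family_le => N; rewrite -fsq_coord_mx coord_mx_twist.
exact: le_trans (q1 _ _) (fsq_coord_mx_le _ _).
Qed.

(** The N x N upper left corner of the infinite matrix of [a]. *)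
Definition corner N (a : l2 -> l2) : 'M[C]_N :=
  \matrix_(r, m) a (ell2_of (fun k => (k == m)%:R) m.+1) r.

Lemma corner_ell2_of N (a : l2 -> l2) f (r : 'I_N) : linear a ->
  a (ell2_of f N) r = \sum_m corner N a r m * f m.
Proof.
move=> la; rewrite (@functional_ell2_of R (fun x => a x r)).
  by apply: eq_bigr => m _; rewrite mxE mulrC.
by move=> c x y; rewrite la.
Qed.

Lemma corner_mulmx N (a : l2 -> l2) (v : 'cV[C]_N.+1) r : linear a ->
  (corner N.+1 a *m v) r 0 = a (ell2_of (fun k => v (inord k) 0) N.+1) r.
Proof.
move=> la; rewrite corner_ell2_of // mxE; apply: eq_bigr => m _.
by rewrite inord_val.
Qed.

Lemma rc_contraction_conj N n (a : 'I_n -> 'M[C]_N) :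
  rc_contraction a -> rc_contraction (fun j => map_mx Num.conj (a j)).
Proof.
move=> [ca ra]; have cj (b : 'M[C]_N) (v : 'cV[C]_N) : map_mx Num.conj b *m v =
    map_mx Num.conj (b *m map_mx Num.conj v).
  rewrite map_mxM; congr (_ *m _); apply/matrixP => i j.
  by rewrite [RHS]mxE [in RHS]mxE; exact: (esym (conjCK _)).
split=> v.
  under eq_bigr do rewrite cj fsq_conj.
  by apply: le_trans (ca _) _; rewrite fsq_conj.
under eq_bigr do rewrite cj.
rewrite -raddf_sum fsq_conj; apply: le_trans (ra _) _.
by apply: ler_sum => j _; rewrite fsq_conj.
Qed.

Lemma corner_rc_contraction N n (a : 'I_n -> (l2 -> l2)) (c : R) : 0 < c ->
  (forall j, linear (a j)) ->
  (forall x, \sum_j rnorm (a j x) ^+ 2 <= c ^+ 2 * rnorm x ^+ 2) ->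
  (forall x : 'I_n -> l2, rnorm (\sum_j a j (x j)) ^+ 2 <= c ^+ 2 * \sum_j rnorm (x j) ^+ 2) ->
  rc_contraction (fun j => ((c^-1)%:C)%C *: corner N.+1 (a j)).
Proof.
move=> c0 la ca ra.
have sq_sum (v : 'cV[C]_N.+1) (x : l2) : (forall r : 'I_N.+1, v r 0 = x r) ->
    fsq v <= rnorm x ^+ 2.
  move=> vx; have := ell2_sum_le_rnorm x N.+1; rewrite /series /= big_mkord.
  by rewrite col_fsqE; congr (_ <= _); apply: eq_bigr => r _; rewrite vx.
pose e (v : 'cV[C]_N.+1) := ell2_of (fun k => v (inord k) 0) N.+1.
have fe v : rnorm (e v) ^+ 2 = fsq v.
  by rewrite rnorm_ell2_of col_fsqE; apply: eq_bigr => r _; rewrite inord_val.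
split=> [v|v].
  under eq_bigr do rewrite -scalemxAl fsqR.
  rewrite -mulr_sumr exprVn ler_pdivrMl ?exprn_gt0 // -fe; apply: le_trans (ca _).
  by apply: ler_sum => j _; apply: sq_sum => r; exact: corner_mulmx.
under eq_bigr do rewrite -scalemxAl.
rewrite -scaler_sumr fsqR exprVn ler_pdivrMl ?exprn_gt0 //.
under [X in _ <= _ * X]eq_bigr do rewrite -fe.
apply: le_trans (ra _); apply: sq_sum => r; rewrite summxE.
rewrite (eq_bigr (fun j => 1 * a j (e (v j)) r)); last first.
  by move=> j _; rewrite mul1r; exact: corner_mulmx.
by rewrite -ell2_sumE; under [in RHS]eq_bigr do rewrite -[a _ _]scale1r.
Qed.
End Corners.

(** * Free test matrices for compact operators *)

Section FreeTensorTest.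
Variable R : realType.
Local Notation C := R[i].
Local Notation l2 := (ell2 R).

Lemma rdot_le_sqr p q (A B : 'M[C]_(p, q)) (x y c : R) :
  fsq A <= x -> fsq B <= y -> 0 <= c -> x * y <= c ^+ 2 -> rdot A B <= c.
Proof.
move=> Ax By c0 xy; apply: le_trans (ler_norm _) _.
rewrite -(@ler_pXn2r _ 2) ?nnegrE // real_normK ?num_real //.
apply: le_trans (rdot_CS _ _) _; apply: le_trans xy.
by apply: ler_pM; rewrite ?fsq_ge0.
Qed.

Lemma colsub1E n k (s : 'I_n -> 'I_k -> 'I_k) j h g :
  colsub (s j) (1%:M : 'M[C]_k) h g = (h == s j g)%:R.
Proof. by rewrite !mxE. Qed.

Lemma rdot_perm n k (s : 'I_n -> 'I_k -> 'I_k) i j (c : C) :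
  (forall i j h, s i h = s j h -> i = j) ->
  rdot (c *: colsub (s i) 1%:M) (colsub (s j) 1%:M) =
  (if i == j then complex.Re c else 0) * k%:R.
Proof.
move=> sI; rewrite /rdot exchange_big /=.
rewrite (eq_bigr (fun=> if i == j then complex.Re c else 0)); last first.
  move=> g _; rewrite (bigD1 (s j g)) //= big1 ?addr0 => [|h hg]; last first.
    by rewrite [in X in cdot _ X]colsub1E (negbTE hg) cdotC cdot0l.
  rewrite mxE !colsub1E eqxx; have [->|ij] := eqVneq i j.
    by rewrite eqxx mulr1 /cdot /= mulr1 mulr0 addr0.
  rewrite (_ : (s j g == s i g) = false) ?mulr0 ?cdot0l //.
  by apply/negP => /eqP /sI ji; rewrite ji eqxx in ij.
by rewrite sumr_const card_ord mulr_natr.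
Qed.

Lemma fsq_unit k : fsq (1%:M : 'M[C]_k) = k%:R.
Proof.
have := @rdot_perm 1 k (fun _ => id) 0 0 1 (fun i j _ _ => etrans (ord1 i) (esym (ord1 j))).
rewrite eqxx scale1r /= mul1r => <-.
by congr rdot; apply/matrixP => i j; rewrite !mxE.
Qed.

(** The matrices p U_j are almost orthogonal of square norm [k]: this holds for the
    permutation matrices U_j, which have disjoint supports, and p is close to 1 in
    Hilbert-Schmidt norm. *)
Lemma free_pairing n k (s : 'I_n -> 'I_k -> 'I_k) (p : 'M[C]_k) (d : R) j (c : 'I_n -> C) :
  (forall j, involutive (s j)) -> (forall i j h, s i h = s j h -> i = j) ->
  (forall q (z : 'M[C]_(q, k)), fsq (z *m p) <= fsq z) ->
  0 <= d -> fsq (1%:M - p) <= d ^+ 2 * k%:R -> (forall i, rnorm (c i) <= 1) ->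
  (complex.Re (c j) - 2 * d * n%:R) * k%:R <=
    rdot (\sum_i c i *: colsub (s i) p) (colsub (s j) p).
Proof.
move=> sK sI p1 d0 pd c1.
have k0 : 0 <= k%:R :> R by rewrite ler0n.
have c2 i : rnorm (c i) ^+ 2 <= 1 by rewrite expr_le1 ?rnorm_ge0.
have fp : fsq p <= k%:R by have := p1 _ 1%:M; rewrite mul1mx fsq_unit.
rewrite rdot_suml.
have -> : (complex.Re (c j) - 2 * d * n%:R) * k%:R =
   \sum_i ((if i == j then complex.Re (c i) else 0) - 2 * d) * k%:R.
  rewrite -mulr_suml; congr (_ * _); rewrite big_split /= -big_mkcond big_pred1_eq.
  by rewrite sumr_const card_ord mulNrn mulr_natr.
apply: ler_sum => i _; rewrite mulrBl -(rdot_perm _ _ _ sI).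
set U := fun i => colsub (s i) (1%:M : 'M[C]_k); set q := fun i => colsub (s i) p.
have qU l : q l = U l - (colsub (s l) (1%:M - p)).
  by apply/matrixP => x y; rewrite !mxE opprD addNKr opprK.
rewrite -!/(q _) -!/(U _).
have h1 : rdot (c i *: colsub (s i) (1%:M - p)) (U j) <= d * k%:R.
  apply: (@rdot_le_sqr _ _ _ _ (d ^+ 2 * k%:R) k%:R); rewrite ?mulr_ge0 //.
  - by rewrite fsqZ fsq_colsub //; apply: le_trans pd; rewrite ler_piMl ?fsq_ge0.
  - by rewrite /U fsq_colsub // fsq_unit.
  - by rewrite exprMn mulrA.
have h2 : rdot (c i *: q i) (colsub (s j) (1%:M - p)) <= d * k%:R.
  apply: (@rdot_le_sqr _ _ _ _ k%:R (d ^+ 2 * k%:R)); rewrite ?mulr_ge0 //.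
  - by rewrite fsqZ /q fsq_colsub //; apply: le_trans fp; rewrite ler_piMl ?fsq_ge0.
  - by rewrite fsq_colsub.
  - by rewrite exprMn mulrCA -expr2.
rewrite (qU j) rdotDr rdotNr.
have -> : rdot (c i *: q i) (U j) = rdot (c i *: U i) (U j) -
    rdot (c i *: colsub (s i) (1%:M - p)) (U j).
  by rewrite (qU i) scalerBr rdotDl rdotNl.
lra.
Qed.

Lemma mulmx_colsub N n k (s : 'I_n -> 'I_k -> 'I_k) j (z : 'M[C]_(N, k)) (p : 'M[C]_k) :
  colsub (s j) (z *m p) = z *m colsub (s j) p.
Proof. by apply/matrixP => x y; rewrite !mxE; apply: eq_bigr => i _; rewrite !mxE. Qed.

(** [free_test_matrices] for the corners of the operators [a j], whose size is chosen
    before that of the test matrices.  The corners approximate the operators with an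
    error c / n for each, which costs no more than the main term because the test
    matrices are contractions. *)
Lemma free_tensor_test n (a : 'I_n.+1 -> (l2 -> l2)) (c d : R) : 0 < c -> 0 < d ->
  (forall j, compact_ops (H := l2) (a j)) ->
  (forall x, \sum_j rnorm (a j x) ^+ 2 <= c ^+ 2 * rnorm x ^+ 2) ->
  (forall x : 'I_n.+1 -> l2,
     rnorm (\sum_j a j (x j)) ^+ 2 <= c ^+ 2 * \sum_j rnorm (x j) ^+ 2) ->
  exists k (q : 'I_n.+1 -> 'M[C]_k.+1), [/\
    forall (f : 'I_n.+1 -> C) (z : 'rV[C]_k.+1), \sum_j rnorm (f j) ^+ 2 <= 1 ->
      fsq (\sum_j f j *: (z *m q j)) <= 12 ^+ 2 * fsq z,
    forall (f : 'I_n.+1 -> C) j, (forall i, rnorm (f i) <= 1) ->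
      (complex.Re (f j) - 2 * d * n.+1%:R) * k.+1%:R <= rdot (\sum_i f i *: q i) (q j) &
    forall xi : 'I_k.+1 -> l2,
      \sum_g rnorm (\sum_j a j (twist (q j) xi g)) ^+ 2 <=
      (6 * c) ^+ 2 * \sum_h rnorm (xi h) ^+ 2].
Proof.
move=> c0 d0 Ka ca ra; have la j : linear (a j) by have [[]] := Ka j.
have n0 : 0 < n.+1%:R :> R by rewrite ltr0n.
have ac j x : rnorm (a j x) <= c * rnorm x.
  rewrite -ler_sqr ?nnegrE ?rnorm_ge0 ?mulr_ge0 ?rnorm_ge0 ?(ltW c0) // exprMn.
  apply: le_trans (ca x); rewrite (bigD1 j) //= lerDl.
  by apply: sumr_ge0 => i _; exact: sqr_ge0.
have e0 : 0 < c / n.+1%:R by rewrite divr_gt0.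
have [N0 hN0] := choice (fun j => compact_op_trunc_near (la j) (ac j) (Ka j).2 e0).
pose N := (\max_j N0 j).+1.
have near j x : rnorm (a j x - trunc N (a j (trunc N x))) <= c / n.+1%:R * rnorm x.
  by apply: hN0; apply: leqW; exact: leq_bigmax.
have rcA := rc_contraction_conj (@corner_rc_contraction R (\max_j N0 j) _ _ _ c0 la ca ra).
have d20 : 0 < d ^+ 2 by rewrite exprn_gt0.
have [k [s [p [[sK sI] p1 pd op16 sc]]]] := free_test_matrices rcA d20.
exists k, (fun j => colsub (s j) p).
have q1 j M (z : 'M[C]_(M, k.+1)) : fsq (z *m colsub (s j) p) <= fsq z.
  by rewrite -mulmx_colsub fsq_colsub.
split.
- move=> f z f1; pose e : 'cV[C]_N := delta_mx 0 0.
  have fe (v : 'rV[C]_k.+1) : fsq (e *m v) = fsq v.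
    rewrite {1}/fsq rdot_mulmxl mulmxA.
    have -> : adj e *m e = 1%:M.
      by rewrite adj_mul_self fsq_delta.
    by rewrite mul1mx.
  have := sc f (e *m z) f1; rewrite fe => h; rewrite -(fe (\sum_j _)) mulmx_sumr.
  rewrite (eq_bigr (fun j => f j *: colsub (s j) (e *m z *m p))) //.
  by move=> j _; rewrite mulmx_colsub -scalemxAr mulmxA.
- by move=> f j f1; apply: free_pairing => //; exact: ltW.
move=> xi; pose th j := twist (colsub (s j) p) xi.
have fth j : \sum_g rnorm (th j g) ^+ 2 <= \sum_h rnorm (xi h) ^+ 2.
  by apply: twist_contraction => M z; exact: q1.
set X := \sum_h rnorm (xi h) ^+ 2.
(* b is the contribution of the corners and r the error. *)
pose b g := trunc N (\sum_j a j (trunc N (th j g))).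
pose r g := \sum_j (a j (th j g) - trunc N (a j (trunc N (th j g)))).
have split_g g : \sum_j a j (th j g) = b g + r g.
  rewrite /r big_split /= sumrN /b addrCA.
  have -> : trunc N (\sum_j a j (trunc N (th j g))) = \sum_j trunc N (a j (trunc N (th j g))).
    exact: linear_is_sum (@trunc_linear R N).
  by rewrite subrr addr0.
have br : \sum_g rnorm (r g) ^+ 2 <= c ^+ 2 * X.
  apply: (@le_trans _ _ (\sum_g (n.+1%:R * \sum_j (c / n.+1%:R) ^+ 2 * rnorm (th j g) ^+ 2))).
    apply: ler_sum => g _; apply: le_trans (rnorm_sum_sqr_le _) _.
    rewrite ler_pM2l //; apply: ler_sum => j _; rewrite -exprMn ler_sqr ?nnegrE ?rnorm_ge0 //.
    by rewrite mulr_ge0 ?rnorm_ge0 // ltW.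
  rewrite -mulr_sumr exchange_big /=.
  under eq_bigr do rewrite -mulr_sumr.
  rewrite -mulr_sumr mulrA.
  apply: (@le_trans _ _ (n.+1%:R * (c / n.+1%:R) ^+ 2 * \sum_(j < n.+1) X)).
    apply: ler_wpM2l; first by rewrite mulr_ge0 ?sqr_ge0 ?ler0n.
    by apply: ler_sum => j _; exact: fth.
  rewrite sumr_const card_ord -[X in _ * X]mulr_natl.
  by rewrite (_ : _ * _ = c ^+ 2 * X) //; field; rewrite nat1r pnatr_eq0.
have bb : \sum_g rnorm (b g) ^+ 2 <= 16 * c ^+ 2 * X.
  have coordE j (x : l2) (i : 'I_N) : (a j (trunc N x) i)^* =
      \sum_m map_mx Num.conj (corner N (a j)) i m * (x m)^*.
    rewrite /trunc corner_ell2_of // rmorph_sum /=; apply: eq_bigr => m _.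
    by rewrite rmorphM [in RHS]mxE.
  pose Z := coord_mx N xi.
  have E g (i : 'I_N) : (b g i)^* =
      ((c%:C%C) *: tensor_op s (fun j => map_mx Num.conj ((c^-1)%:C%C *: corner N (a j))) (Z *m p)) i g.
    rewrite /tensor_op scaler_sumr summxE /b ell2_ofE ltn_ord.
    have -> : (\sum_j a j (trunc N (th j g))) i = \sum_j a j (trunc N (th j g)) i.
      by apply: (big_morph (fun y : l2 => y i)).
    rewrite rmorph_sum /=; apply: eq_bigr => j _; rewrite coordE.
    rewrite mulmx_colsub -coord_mx_twist -/(th j) mxE [X in _ * X]mxE mulr_sumr.
    apply: eq_bigr => m _; rewrite !mxE rmorphM /= conj_real !mulrA.
    have -> : (c%:C%C) * ((c^-1)%:C%C) = 1 :> C by rewrite -rmorphM /= divff // gt_eqF.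
    by rewrite mul1r.
  have -> : \sum_g rnorm (b g) ^+ 2 = c ^+ 2 *
     fsq (tensor_op s (fun j => map_mx Num.conj ((c^-1)%:C%C *: corner N (a j))) (Z *m p)).
    rewrite -fsqR fsqE exchange_big /=; apply: eq_bigr => g _.
    by rewrite rnorm_ell2_of; apply: eq_bigr => i _; rewrite -E rnorm_conj /b ell2_ofE ltn_ord.
  rewrite (_ : 16 * c ^+ 2 * X = c ^+ 2 * (16 * X)) ?ler_pM2l ?exprn_gt0 //; last by ring.
  apply: le_trans (op16 _) _; rewrite ler_pM2l //.
  exact: fsq_coord_mx_le.
apply: (@le_trans _ _ (\sum_g (2 * rnorm (b g) ^+ 2 + 2 * rnorm (r g) ^+ 2))).
  apply: ler_sum => g _; rewrite split_g; apply: sqr_le_2sqrD; first exact: rnorm_ge0.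
  exact: ler_rnormD.
rewrite big_split /= -!mulr_sumr exprMn.
have X0 : 0 <= c ^+ 2 * X by apply: le_trans br; apply: sumr_ge0 => g _; exact: sqr_ge0.
lra.
Qed.

End FreeTensorTest.

(** * Operators on l2 given by finite matrices, rows and columns *)

Section MatrixTests.
Variable R : realType.
Local Notation C := R[i].
Local Notation l2 := (ell2 R).

Lemma fsq_mulmx n k (z : 'rV[C]_n) (M : 'M[C]_(n, k)) : fsq (z *m M) <= fsq z * fsq M.
Proof.
rewrite fsq_col [fsq M]fsq_col mulr_sumr; apply: ler_sum => g _.
by rewrite colE -mulmxA -colE; exact: fsq_row_col.
Qed.

Lemma cdotE (z w : C) : cdot z w = complex.Re (w^* * z).
Proof. by case: z w => [a b] [c d]; rewrite /cdot /=; ring. Qed.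

Section MatrixOperator.
Variable k : nat.

Definition coord_row (x : l2) : 'rV[C]_k.+1 := \row_h x h.

(** The matrix [M], acting on row vectors, as an operator on the first [k + 1]
    coordinates of l2. *)
Definition op_of_mx (M : 'M[C]_k.+1) (x : l2) : l2 :=
  ell2_of (fun g => (coord_row x *m M) 0 (inord g)) k.+1.

Definition unit_vec (h : 'I_k.+1) : l2 := ell2_of (fun i => (i == h)%:R) h.+1.

Lemma fsq_coord_row x : fsq (coord_row x) <= rnorm x ^+ 2.
Proof.
apply: le_trans (ell2_sum_le_rnorm x k.+1); rewrite /series /= big_mkord fsqE big_ord1.
by apply: ler_sum => h _; rewrite mxE.
Qed.

Lemma rnorm_op_of_mx M x : rnorm (op_of_mx M x) ^+ 2 = fsq (coord_row x *m M).
Proof.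
rewrite rnorm_ell2_of fsqE big_ord1; apply: eq_bigr => g _.
by rewrite inord_val.
Qed.

Lemma op_of_mxE M x (g : 'I_k.+1) : op_of_mx M x g = (coord_row x *m M) 0 g.
Proof. by rewrite ell2_ofE ltn_ord inord_val. Qed.

Lemma coord_row_unit_vec h : coord_row (unit_vec h) = delta_mx 0 h.
Proof.
apply/matrixP => i j; rewrite (ord1 i) !mxE ell2_ofE eqxx /= ltnS.
have [->|jh] := eqVneq j h; first by rewrite leqnn eqxx.
by rewrite (_ : (nat_of_ord j == h) = false) ?if_same //; apply/negbTE.
Qed.

Lemma rnorm_unit_vec h : rnorm (unit_vec h) ^+ 2 = 1.
Proof.
rewrite rnorm_ell2_of (bigD1 ord_max) //= eqxx big1 ?addr0.
  by rewrite /rnorm normr1 /= expr1n.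
move=> i ih; rewrite (_ : (nat_of_ord i == h) = false) ?rnorm0 ?expr0n //.
by apply/negbTE.
Qed.

Lemma op_of_mx_unit_vec M (h g : 'I_k.+1) : op_of_mx M (unit_vec h) g = M h g.
Proof. by rewrite op_of_mxE coord_row_unit_vec -rowE mxE. Qed.

Lemma op_of_mx_linear M : linear (op_of_mx M).
Proof.
move=> c x y; apply: ell2_eq => i.
have crD : coord_row (c *: x + y) = c *: coord_row x + coord_row y.
  by apply/matrixP => a b; rewrite !mxE.
have -> : (c *: op_of_mx M x + op_of_mx M y) i = c * op_of_mx M x i + op_of_mx M y i by [].
rewrite !ell2_ofE; case: ifP => _; last by rewrite mulr0 addr0.
by rewrite crD mulmxDl -scalemxAl !mxE.
Qed.

Lemma op_of_mx_linear_mx c M N : op_of_mx (c *: M + N) = c *: op_of_mx M + op_of_mx N.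
Proof.
apply/funext => x; apply: ell2_eq => i.
have -> : (c *: op_of_mx M + op_of_mx N) x i = c * op_of_mx M x i + op_of_mx N x i by [].
rewrite !ell2_ofE; case: ifP => _; last by rewrite mulr0 addr0.
by rewrite mulmxDr -scalemxAr !mxE.
Qed.

Lemma op_of_mx_bounded M : bounded_ops (H := l2) (op_of_mx M).
Proof.
apply/bounded_opsP; split; first exact: op_of_mx_linear.
have M1 : 0 < fsq M + 1 by rewrite ltr_wpDl ?fsq_ge0.
exists (fsq M + 1) => // x; rewrite -ler_sqr ?nnegrE ?rnorm_ge0 ?mulr_ge0 ?rnorm_ge0 ?(ltW M1) //.
rewrite rnorm_op_of_mx exprMn; apply: le_trans (fsq_mulmx _ _) _.
rewrite mulrC; apply: ler_pM; rewrite ?fsq_ge0 ?fsq_coord_row //.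
by rewrite expr2 mulrDl mul1r mulrDr mulr1; have := fsq_ge0 M; have := sqr_ge0 (fsq M); rewrite expr2; lra.
Qed.
End MatrixOperator.

Section RowColumn.
Variables (H : hilbertType R) (n : nat) (S : 'I_n.+1 -> (H -> H)).

Definition column_mx : 'M[H -> H]_n.+1 := \matrix_(i, j) (if j == 0 then S i else 0).
Definition row_of_ops : 'M[H -> H]_n.+1 := \matrix_(i, j) (if i == 0 then S j else 0).

Lemma mx_apply_column (xi : 'cV[H]_n.+1) i : mx_apply column_mx xi i 0 = S i (xi 0 0).
Proof.
rewrite mxE (bigD1 0) //= mxE eqxx big1 ?addr0 // => j j0.
by rewrite mxE (negbTE j0).
Qed.

Lemma mx_apply_row (xi : 'cV[H]_n.+1) i :
  mx_apply row_of_ops xi i 0 = if i == 0 then \sum_j S j (xi j 0) else 0.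
Proof.
rewrite mxE; case: ifP => i0; first by apply: eq_bigr => j _; rewrite mxE i0.
by rewrite big1 // => j _; rewrite mxE i0.
Qed.

Lemma colsq_column (xi : 'cV[H]_n.+1) :
  colsq (mx_apply column_mx xi) = \sum_i rnorm (S i (xi 0 0)) ^+ 2.
Proof. by apply: eq_bigr => i _; rewrite mx_apply_column. Qed.

Lemma colsq_row (xi : 'cV[H]_n.+1) :
  colsq (mx_apply row_of_ops xi) = rnorm (\sum_j S j (xi j 0)) ^+ 2.
Proof.
rewrite /colsq (bigD1 0) //= mx_apply_row eqxx [X in _ + X]big1 ?addr0 // => i i0.
by rewrite mx_apply_row (negbTE i0) rnorm0 expr0n.
Qed.
End RowColumn.

(** Apply the cb norm of [u] to the column and to the row of the [S j], whose norms are
    at most (n + 1)^(1/2) by the Cauchy-Schwarz inequality. *)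
Lemma row_column_bounds (H K : hilbertType R) (E : set (H -> H)) (F : set (K -> K)) u
    (b : R) n (S : 'I_n.+1 -> (H -> H)) :
  is_subspace E -> linear_map E F u -> F `<=` bounded_ops (H := K) ->
  (cb_norm E u <= b%:E)%E -> 0 <= b -> (forall j, E (S j)) ->
  (forall j x, rnorm (S j x) <= rnorm x) ->
  (forall x, \sum_j rnorm (u (S j) x) ^+ 2 <= (Num.sqrt n.+1%:R * b) ^+ 2 * rnorm x ^+ 2) /\
  (forall x : 'I_n.+1 -> K, rnorm (\sum_j u (S j) (x j)) ^+ 2 <=
     (Num.sqrt n.+1%:R * b) ^+ 2 * \sum_j rnorm (x j) ^+ 2).
Proof.
move=> sE lu Fb cu b0 ES S1; have u0 := linear_map0 sE lu.
have s0 : 0 < Num.sqrt n.+1%:R :> R by rewrite sqrtr_gt0 ltr0n.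
have s2 : Num.sqrt n.+1%:R ^+ 2 = n.+1%:R :> R by rewrite sqr_sqrtr ?ler0n.
have S2 j x : rnorm (S j x) ^+ 2 <= rnorm x ^+ 2 by rewrite ler_sqr ?nnegrE ?rnorm_ge0.
split=> x.
  have uC : map_mx u (column_mx S) = column_mx (fun j => u (S j)).
    by apply/matrixP => i j; rewrite !mxE; case: ifP.
  pose xi : 'cV[K]_n.+1 := \col_i (if i == 0 then x else 0).
  have xi0 : xi 0 0 = x by rewrite mxE eqxx.
  have fxi : colsq xi = rnorm x ^+ 2.
    rewrite /colsq (bigD1 0) //= xi0 big1 ?addr0 // => i i0.
    by rewrite mxE (negbTE i0) rnorm0 expr0n.
  have := @cb_norm_apply R H K E F u b _ n.+1 (column_mx S) xi sE lu Fb cu b0 s0.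
  rewrite uC colsq_column xi0 fxi; apply.
    by move=> i j; rewrite mxE; case: ifP => _ //; exact: sE.1.
  move=> zeta; rewrite colsq_column s2.
  apply: (@le_trans _ _ (\sum_(i < n.+1) rnorm (zeta 0 0) ^+ 2)); first exact: ler_sum.
  rewrite sumr_const card_ord -[leLHS]mulr_natl ler_wpM2l ?ler0n //.
  by rewrite /colsq (bigD1 0) //= lerDl; apply: sumr_ge0 => i _; exact: sqr_ge0.
have uC : map_mx u (row_of_ops S) = row_of_ops (fun j => u (S j)).
  by apply/matrixP => i j; rewrite !mxE; case: ifP.
pose xi : 'cV[K]_n.+1 := \col_i x i.
have := @cb_norm_apply R H K E F u b _ n.+1 (row_of_ops S) xi sE lu Fb cu b0 s0.
rewrite uC colsq_row (eq_bigr (fun j => u (S j) (x j))) => [|j _]; last by rewrite mxE.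
rewrite (_ : colsq xi = \sum_j rnorm (x j) ^+ 2); last first.
  by apply: eq_bigr => j _; rewrite mxE.
apply.
  by move=> i j; rewrite mxE; case: ifP => _ //; exact: sE.1.
move=> zeta; rewrite colsq_row s2; apply: le_trans (rnorm_sum_sqr_le _) _.
by rewrite ler_wpM2l ?ler0n //; exact: ler_sum.
Qed.

End MatrixTests.

(** * The lower bound *)

Section LowerBound.
Variable R : realType.
Local Notation C := R[i].
Local Notation l2 := (ell2 R).

Lemma opnorm_apply (H : hilbertType R) (T : H -> H) (b : R) (x : H) :
  linear T -> (opnorm T <= b%:E)%E -> rnorm (T x) <= b * rnorm x.
Proof.
move=> lT Tb; have [x0|x0] := eqVneq (rnorm x) 0.
  by rewrite (rnorm_eq0 x0) (linear_is0 lT) (rnorm0 H) mulr0.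
have xp : 0 < rnorm x by rewrite lt_neqAle eq_sym x0 rnorm_ge0.
rewrite -ler_pdivrMr // mulrC -lee_fin; apply: le_trans Tb.
apply: ereal_sup_ubound; exists (((rnorm x)^-1)%:C%C *: x) => /=.
  by rewrite rnormZ rnorm_real gtr0_norm ?invr_gt0 // mulVf.
by rewrite (linear_isZ _ _ lT) rnormZ rnorm_real gtr0_norm ?invr_gt0.
Qed.

(** The left side is the pairing of [Z] with the maximally entangled vector: its
    square norm, and that of its counterpart on the other side, is [k + 1]. *)
Lemma pairing_le k (Z : 'M[l2 -> l2]_k.+1) (b : R) : 0 <= b ->
  (forall xi, colsq (mx_apply Z xi) <= b ^+ 2 * colsq xi) ->
  \sum_g \sum_h complex.Re (Z g h (unit_vec R h) g) <= b * k.+1%:R.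
Proof.
move=> b0 Zb; pose xi : 'cV[l2]_k.+1 := \col_h unit_vec R h.
have fxi : colsq xi = k.+1%:R.
  rewrite /colsq (eq_bigr (fun=> 1)) => [|h _]; last by rewrite mxE rnorm_unit_vec.
  by rewrite sumr_const card_ord.
pose y g := mx_apply Z xi g 0.
have yE g : \sum_h complex.Re (Z g h (unit_vec R h) g) = complex.Re (y g g).
  rewrite /y mxE (eq_bigr (fun h => 1 *: Z g h (unit_vec R h))) => [|h _]; last first.
    by rewrite mxE scale1r.
  rewrite ell2_sumE (big_morph (@complex.Re R) (id1 := 0) (op1 := +%R)) //.
    by apply: eq_bigr => h _; rewrite mul1r.
  by move=> [? ?] [? ?].
under eq_bigr do rewrite yE.
apply: (@le_trans _ _ (\sum_g rnorm (y g))).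
  apply: ler_sum => g _; apply: le_trans (ler_norm _) _.
  by apply: le_trans (ler_Re_rnorm _) _; exact: ell2_coord_le.
have s0 : 0 <= \sum_g rnorm (y g) by apply: sumr_ge0 => g _; exact: rnorm_ge0.
rewrite -ler_sqr ?nnegrE ?mulr_ge0 ?ler0n //; apply: le_trans (sqr_sum_le _) _.
have := Zb xi; rewrite fxi exprMn expr2 => yb.
rewrite [k.+1%:R ^+ 2]expr2 mulrA mulrC ler_wpM2r ?ler0n //.
Qed.

Lemma sqr_dimension_bound (m s b lam : R) : 0 < s -> s ^+ 2 = m -> 0 < b -> b <= lam ->
  m * (3 / 8) <= 72 * b * s -> m <= (192 * lam) ^+ 2.
Proof.
move=> s0 <- b0 bl; have -> : s ^+ 2 * (3 / 8) = 3 / 8 * s * s by ring.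
rewrite ler_pM2r // => sb.
have sl : s <= 192 * lam by lra.
by rewrite ler_sqr ?nnegrE ?(ltW s0) // (le_trans (ltW s0)).
Qed.

End LowerBound.

Theorem mainTheorem6 (R : realType) (X : completeNormedModType R[i])
    (H : hilbertType R) (J : X -> (H -> H)) :
  ~ finite_dim [set: X]%classic -> is_max J -> ~ exact_space (range J)%classic.
Proof.
move=> infX [Jlin Jb Jiso Jmax] exJ.
have Yb : range J `<=` bounded_ops (H := H) by move=> _ [v _ <-]; exact: Jb.
have rJ : is_subspace (range J).
  split; first by exists 0 => //; exact: linear_is0 Jlin.
  by move=> c _ _ [v _ <-] [v' _ <-]; exists (c *: v + v') => //; exact: Jlin.
have [lam lam0 fact] := exact_subspace_factorization Yb exJ.
pose n := Num.bound ((192 * lam) ^+ 2).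
(* The dimension beyond which the two estimates contradict each other. *)
have nbig : (192 * lam) ^+ 2 < n.+1%:R.
  apply: lt_trans (archi_boundP (sqr_ge0 _)) _.
  by rewrite ltr_nat.
have m0 : 0 < n.+1%:R :> R by rewrite ltr0n.
have [f [x [lf f2 x1 fx]]] := dvoretzky_rogers Jlin Jiso infX n.+1.
pose E : set (H -> H) := [set \sum_i c i *: J (x i) | c in [set: 'I_n.+1 -> R[i]]].
have EJ j : E (J (x j)).
  exists (fun i => (i == j)%:R) => //; rewrite (bigD1 j) //= eqxx scale1r big1 ?addr0 //.
  by move=> i /negbTE ->; rewrite scale0r.
have sE : is_subspace E.
  split; first by exists (fun=> 0) => //; rewrite big1 // => i _; rewrite scale0r.
  move=> c _ _ [c1 _ <-] [c2 _ <-]; exists (fun i => c * c1 i + c2 i) => //.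
  rewrite scaler_sumr -big_split /=; apply: eq_bigr => i _.
  by rewrite scalerDl scalerA.
have EY : E `<=` range J.
  move=> _ [c _ <-]; exists (\sum_i c i *: x i) => //.
  by rewrite (linear_is_sum _ _ Jlin); apply: eq_bigr => i _; rewrite (linear_isZ _ _ Jlin).
have J0 : J (x ord0) != 0.
  apply/eqP => Jx0; have := fx ord0; rewrite Jx0.
  have -> : f ord0 0 = 0 by have := scalar_funB 0 0 (lf ord0); rewrite !subrr.
  by rewrite /= ; lra.
have fE : finite_dim E by exists n.+1, (fun i => J (x i)).
have [F [u [t [bu [bt [[sF Fc] [lu lt] tu [bu0 bt0] [cu ct but]]]]]]] :=
  fact E _ sE fE EY (EJ ord0) J0.
have Fb : F `<=` bounded_ops (H := ell2 R) by move=> T /Fc[].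
have Eb : E `<=` bounded_ops (H := H) by move=> T /EY/Yb.
have Jx j h : rnorm (J (x j) h) <= rnorm h.
  apply: le_trans (opnorm_apply h (Jb _).1 _) _; first by rewrite Jiso.
  by rewrite ler_piMl ?rnorm_ge0.
have [ca ra] := row_column_bounds sE lu Fb cu (ltW bu0) EJ Jx.
set sm := Num.sqrt n.+1%:R in ca ra.
have sm0 : 0 < sm by rewrite sqrtr_gt0.
have sm2 : sm ^+ 2 = n.+1%:R by rewrite sqr_sqrtr ?ler0n.
have c0 : 0 < sm * bu by rewrite mulr_gt0.
(* With this precision the off-diagonal terms of the pairing sum to at most 1/8. *)
have d0 : 0 < (16 * n.+1%:R)^-1 :> R by rewrite invr_gt0 mulr_gt0.
have Ka j : compact_ops (H := ell2 R) (u (J (x j))) by apply: Fc; exact: lu.1.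
have [k [q [q12 qpair qbound]]] := free_tensor_test c0 d0 Ka ca ra.
(* The tensor sum_j a_j (x) q_j^*, as a matrix of operators. *)
pose Y : 'M[ell2 R -> ell2 R]_k.+1 := \matrix_(g, h) \sum_j (q j h g)^* *: u (J (x j)).
have FY g h : F (Y g h) by rewrite mxE; apply: subspace_sum => // j; exact: lu.1.
have Ybound xi : colsq (mx_apply Y xi) <= (6 * (sm * bu)) ^+ 2 * colsq xi.
  apply: le_trans (qbound (fun h => xi h 0)); rewrite /colsq.
  rewrite le_eqVlt; apply/orP; left; apply/eqP; apply: eq_bigr => g _.
  congr (rnorm _ ^+ 2); rewrite mxE.
  under eq_bigr do rewrite mxE fct_sumE.
  rewrite exchange_big /=; apply: eq_bigr => j _.
  have la : linear (u (J (x j))) by have [[]] := Ka j.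
  rewrite /twist.
  rewrite (linear_is_sum _ _ la).
  by apply: eq_bigr => h _; rewrite (linear_isZ _ _ la).
have tYbound xi : colsq (mx_apply (map_mx t Y) xi) <= (6 * (sm * bu) * bt) ^+ 2 * colsq xi.
  apply: (cb_norm_apply xi sF lt Eb ct (ltW bt0) _ FY Ybound).
  by rewrite mulr_gt0.
have tYE : map_mx t Y = \matrix_(g, h) \sum_j (q j h g)^* *: J (x j).
  apply/matrixP => g h; rewrite !mxE (linear_map_sum sF lt); last by move=> j; exact: lu.1.
  by apply: eq_bigr => j _; rewrite tu.
(* On the range of J this is the map J x |-> sum_i f_i (x) q_i. *)
pose w (T : H -> H) : ell2 R -> ell2 R := op_of_mx (\sum_i f i T *: q i).
have wlin (c : R[i]) S T : w (c *: S + T) = c *: w S + w T.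
  rewrite /w -op_of_mx_linear_mx; congr op_of_mx.
  rewrite scaler_sumr -big_split /=; apply: eq_bigr => i _.
  by rewrite (lf i) scalerDl scalerA.
have lw : linear_map (range J) (bounded_ops (H := ell2 R)) w.
  by split=> // T _; exact: op_of_mx_bounded.
have cw : (cb_norm (range J) w <= 12%:E)%E.
  rewrite (Jmax _ _ _ (bounded_ops_operator_space (ell2 R)) lw).
  apply: ge_ereal_sup => _ [v v1 <-]; apply: ge_ereal_sup => _ [eta eta1 <-].
  rewrite lee_fin -ler_sqr ?nnegrE ?rnorm_ge0 // rnorm_op_of_mx mulmx_sumr.
  under eq_bigr do rewrite -scalemxAr.
  apply: le_trans (q12 (fun i => f i (J v)) _ _) _.
    by apply: le_trans (f2 v) _; rewrite expr_le1 ?rnorm_ge0.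
  rewrite ler_piMr ?sqr_ge0 //; apply: le_trans (fsq_coord_row _ _) _.
  by rewrite expr_le1 ?rnorm_ge0.
have wbound xi : colsq (mx_apply (map_mx w (map_mx t Y)) xi) <=
    (6 * (sm * bu) * bt * 12) ^+ 2 * colsq xi.
  apply: (@cb_norm_apply R _ _ _ _ w 12 _ _ _ xi rJ lw) => //.
  - by rewrite !mulr_gt0.
  - by move=> g h; rewrite mxE; apply: EY; apply: lt.1.
have b0 : 0 <= 6 * (sm * bu) * bt * 12 by rewrite !mulr_ge0 // ltW.
(* The pairing is the sum over j of the real parts of the traces of
   sum_i f_i (x_j) q_i q_j^*. *)
have := pairing_le b0 wbound.
have -> : \sum_g \sum_h complex.Re (map_mx w (map_mx t Y) g h (unit_vec R h) g) =
    \sum_j rdot (\sum_i f i (J (x j)) *: q i) (q j).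
  rewrite /rdot.
  under [RHS]eq_bigr do rewrite exchange_big /=.
  rewrite [RHS]exchange_big /=; apply: eq_bigr => g _.
  rewrite [RHS]exchange_big /=; apply: eq_bigr => h _.
  rewrite tYE [map_mx w _ g h]mxE [X in w X]mxE.
  have -> : w (\sum_j (q j h g)^* *: J (x j)) = \sum_j (q j h g)^* *: w (J (x j)).
    by apply: (linear_map_sum rJ lw) => j; exists (x j).
  rewrite fct_sumE ell2_sumE (big_morph (@complex.Re R) (id1 := 0) (op1 := +%R)) //; last first.
    by move=> [? ?] [? ?].
  apply: eq_bigr => j _; rewrite cdotE; congr (complex.Re (_ * _)).
  by rewrite op_of_mx_unit_vec.
have lower j : 3 / 8 * k.+1%:R <= rdot (\sum_i f i (J (x j)) *: q i) (q j).
  apply: le_trans (qpair (fun i => f i (J (x j))) j _); last first.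
    move=> i; rewrite -(@expr_le1 _ 2) ?rnorm_ge0 //.
    apply: (@le_trans _ _ (rnorm (x j) ^+ 2)); last by rewrite expr_le1 ?rnorm_ge0.
    apply: le_trans (f2 (x j)); rewrite (bigD1 i) //= lerDl.
    by apply: sumr_ge0 => i' _; exact: sqr_ge0.
  have -> : 2 * (16 * n.+1%:R)^-1 * n.+1%:R = 1 / 8 :> R by field; rewrite gt_eqF.
  rewrite ler_wpM2r ?ler0n //; move: (fx j); clear; set r := complex.Re _; lra.
have : \sum_(j < n.+1) (3 / 8 * k.+1%:R) <= \sum_j rdot (\sum_i f i (J (x j)) *: q i) (q j).
  by apply: ler_sum => j _; exact: lower.
rewrite sumr_const card_ord -[leLHS]mulr_natl mulrA => h1 h2.
have k0 : 0 < k.+1%:R :> R by rewrite ltr0n.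
have {h1 h2} : n.+1%:R * (3 / 8) <= 6 * (sm * bu) * bt * 12.
  by rewrite -(ler_pM2r k0); apply: le_trans h1 h2.
have -> : 6 * (sm * bu) * bt * 12 = 72 * (bu * bt) * sm by ring.
move=> /(sqr_dimension_bound sm0 sm2 (mulr_gt0 bu0 bt0) but).
by rewrite leNgt nbig.
Qed.
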